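(* There is no general recursive function $f:\mathbb{N}\to\mathbb{N}$ such that $D_{1/2}(G)\le f(D_3(G))$ for all finite graphs $G$.
   Context: Graphs are simple undirected graphs viewed as structures for the first-order language with adjacency symbol $\sim$ and equality; formulas use $\neg,\wedge,\vee$ and quantifiers. A sentence $A$ defines a finite graph $G$ if $A$ is true on $G$ and false on every graph (of any cardinality) not isomorphic to $G$. For a formula $A$, $\mathrm{nest}(A)$ is the set of words over $\{\exists,\forall\}$ given by: $\{\text{empty word}\}$ for atomic $A$; $\mathrm{nest}(\neg A)$ is $\mathrm{nest}(A)$ with $\exists,\forall$ interchanged; $\mathrm{nest}(A\wedge B)=\mathrm{nest}(A\vee B)=\mathrm{nest}(A)\cup\mathrm{nest}(B)$; $\mathrm{nest}(QxA)=Q\,\mathrm{nest}(A)$. The alternation number of a word is the number of occurrences of $\exists\forall$ and $\forall\exists$ as consecutive letters; that of $A$ is the maximum over $\mathrm{nest}(A)$. The quantifier rank is the maximum length of a word in $\mathrm{nest}(A)$. $A$ is an $\exists$-formula if every word in $\mathrm{nest}(A)$ having the maximum number of alternations starts with $\exists$. Let $\Phi$ be the set of formulas in negation normal form that either have alternation number $0$, or have alternation number exactly $1$ and are $\exists$-formulas. $D_3(G)$ is the minimum quantifier rank of a sentence in negation normal form with alternation number at most $3$ defining $G$; $D_{1/2}(G)$ is the minimum quantifier rank of a sentence in $\Phi$ defining $G$. *)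

(* Defs.v *)
From mathcomp Require Import all_boot.
Set Implicit Arguments. Unset Strict Implicit. Unset Printing Implicit Defensive.

Inductive rfun : Type :=
| RZero
| RSucc
| RProj (i : nat)
| RComp (g : rfun) (hs : seq rfun)
| RPrec (g h : rfun)
| RMin (g : rfun).

Inductive reval : rfun -> seq nat -> nat -> Prop :=
| ev_zero xs : reval RZero xs 0
| ev_succ x xs : reval RSucc (x :: xs) x.+1
| ev_proj i xs : i < size xs -> reval (RProj i) xs (nth 0 xs i)
| ev_comp g hs xs ys y :
    reval_list hs xs ys -> reval g ys y -> reval (RComp g hs) xs y
| ev_prec0 g h xs y : reval g xs y -> reval (RPrec g h) (0 :: xs) y
| ev_precS g h x xs r y :
    reval (RPrec g h) (x :: xs) r -> reval h (x :: r :: xs) y ->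
    reval (RPrec g h) (x.+1 :: xs) y
| ev_min g xs n :
    reval g (n :: xs) 0 ->
    (forall m, m < n -> exists k, reval g (m :: xs) k.+1) ->
    reval (RMin g) xs n
with reval_list : seq rfun -> seq nat -> seq nat -> Prop :=
| evl_nil xs : reval_list [::] xs [::]
| evl_cons h hs xs y ys :
    reval h xs y -> reval_list hs xs ys -> reval_list (h :: hs) xs (y :: ys).

Definition general_recursive (f : nat -> nat) : Prop :=
  exists p : rfun, forall n, reval p [:: n] (f n).

Inductive form : Type :=
| FAdj (x y : nat)
| FEq (x y : nat)
| FNeg (A : form)
| FAnd (A B : form)
| FOr (A B : form)
| FEx (x : nat) (A : form)
| FAll (x : nat) (A : form).

Fixpoint fv (A : form) : seq nat :=
  match A with
  | FAdj x y | FEq x y => [:: x; y]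
  | FNeg B => fv B
  | FAnd B C | FOr B C => fv B ++ fv C
  | FEx x B | FAll x B => filter (fun y => y != x) (fv B)
  end.

Definition sentence (A : form) : bool := nilp (fv A).

Fixpoint nnf (A : form) : bool :=
  match A with
  | FAdj _ _ | FEq _ _ => true
  | FNeg (FAdj _ _) | FNeg (FEq _ _) => true
  | FNeg _ => false
  | FAnd B C | FOr B C => nnf B && nnf C
  | FEx _ B | FAll _ B => nnf B
  end.

Inductive quant : Type := QEx | QAll.

Definition qswap (q : quant) : quant := match q with QEx => QAll | QAll => QEx end.
Definition qeqb (q r : quant) : bool :=
  match q, r with QEx, QEx | QAll, QAll => true | _, _ => false end.

Fixpoint nest (A : form) : seq (seq quant) :=
  match A with
  | FAdj _ _ | FEq _ _ => [:: [::]]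
  | FNeg B => map (map qswap) (nest B)
  | FAnd B C | FOr B C => nest B ++ nest C
  | FEx _ B => map (cons QEx) (nest B)
  | FAll _ B => map (cons QAll) (nest B)
  end.

Fixpoint word_alt (w : seq quant) : nat :=
  match w with
  | q :: ((r :: _) as w') => (if qeqb q r then 0 else 1) + word_alt w'
  | _ => 0
  end.

Definition alt (A : form) : nat := \max_(w <- nest A) word_alt w.
Definition qrank (A : form) : nat := \max_(w <- nest A) size w.

Definition exists_formula (A : form) : Prop :=
  forall i, i < size (nest A) ->
    word_alt (nth [::] (nest A) i) = alt A ->
    exists w', nth [::] (nest A) i = QEx :: w'.

Definition in_Phi (A : form) : Prop :=
  nnf A /\ (alt A = 0 \/ (alt A = 1 /\ exists_formula A)).

Definition upd (V : Type) (a : nat -> V) (x : nat) (v : V) : nat -> V :=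
  fun y => if y == x then v else a y.

Fixpoint sat (V : Type) (E : V -> V -> Prop) (a : nat -> V) (A : form) : Prop :=
  match A with
  | FAdj x y => E (a x) (a y)
  | FEq x y => a x = a y
  | FNeg B => ~ sat E a B
  | FAnd B C => sat E a B /\ sat E a C
  | FOr B C => sat E a B \/ sat E a C
  | FEx x B => exists v, sat E (upd a x v) B
  | FAll x B => forall v, sat E (upd a x v) B
  end.

(* A graph of arbitrary cardinality (nonempty vertex set, as usual for structures). *)
Record graph : Type := Graph {
  gV : Type;
  gE : gV -> gV -> Prop;
  gE_sym : forall u v, gE u v -> gE v u;
  gE_irr : forall u, ~ gE u u;
  gV_inh : inhabited gV }.

Definition iso_fin (H : graph) (T : finType) (e : rel T) : Prop :=
  exists f : gV H -> T, bijective f /\ forall u v, gE u v <-> e (f u) (f v).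

Definition defines (T : finType) (e : rel T) (A : form) : Prop :=
  sentence A /\
  (forall a : nat -> T, sat (fun u v => e u v) a A) /\
  (forall H : graph, (forall a : nat -> gV H, sat (@gE H) a A) -> iso_fin H e).

Definition D3 (T : finType) (e : rel T) (n : nat) : Prop :=
  (exists A, [/\ nnf A, alt A <= 3, qrank A = n & defines e A]) /\
  (forall A, nnf A -> alt A <= 3 -> defines e A -> n <= qrank A).

Definition Dhalf (T : finType) (e : rel T) (n : nat) : Prop :=
  (exists A, [/\ in_Phi A, qrank A = n & defines e A]) /\
  (forall A, in_Phi A -> defines e A -> n <= qrank A).

(* Main.v *)
Require Import Defs.
From mathcomp Require Import all_boot zify.
From Stdlib Require Import Classical ClassicalEpsilon.
Set Implicit Arguments. Unset Strict Implicit. Unset Printing Implicit Defensive.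

(** If a sentence of Phi with quantifier rank [n] defines [G], keep in [G] one witness per
    Ehrenfeucht-Fraisse type for each existential quantifier: the sentence remains true on the
    induced subgraph, because its universal part passes to substructures, so [G] has no further
    vertices and its order is at most a computable function of [n].

    In contrast, the run of a halting register machine can be written down as a graph that is
    pinned down, even among infinite graphs, by a sentence of shape exists-forall-exists whose
    rank is linear in the size of the program. Time points form a successor chain that is forced
    to stop at the first halting configuration, and the order relation leaves no room for
    nonstandard points. If [f] were recursive, a program with an input [x] hard-wired could run
    for more than [\sum_(i <= 2 x) size_bound (f i)] steps, and its sentence would have rank at
    most [x] plus a constant; taking for [x] that constant contradicts the bound on the order. *)

(** * Quantifier alternation and rank *)

(** The sentence coding a run never mentions the length [N]: its rank counts registers and states
    only, and halting is a fact about the machine, not something the sentence has to assert in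
    advance. Registers start at 0 and grow by at most one per step, so their contents are themselves
    times of the run, and a large output forces a long run. The program is fixed before the input is
    chosen, and the input is prefixed as increments; hence [L] and [C] do not depend on [x] and no
    self-reference is required. Nothing makes [f] monotone, and the coding sentence bounds $D_3$
    only from above; this is why the run must outlast a sum over all possible values of $D_3$.
    Finally, the assumption on [f] compares values that exist, so both minima have to be exhibited;
    for $D_{1/2}$ this takes a separate sentence of Phi defining a given finite graph. *)

Fixpoint blk (q : quant) (A : form) : nat :=
  match A with
  | FAdj _ _ | FEq _ _ => 0
  | FNeg B => blk (qswap q) B
  | FAnd B C | FOr B C => maxn (blk q B) (blk q C)
  | FEx _ B => (~~ qeqb q QEx) + blk QEx B
  | FAll _ B => (~~ qeqb q QAll) + blk QAll B
  end.

Lemma nest_gt0 A : 0 < size (nest A).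
Proof. by elim: A => //= *; rewrite ?size_map ?size_cat ?addn_gt0; lia. Qed.

Lemma bigmax_map_succ (I : Type) (s : seq I) (F G : I -> nat) c :
  0 < size s -> (forall i, F i = c + G i) ->
  \max_(i <- s) F i = c + \max_(i <- s) G i.
Proof.
move=> s_gt0 FG; rewrite (eq_bigr (fun i => c + G i)) => [|i _]; last exact: FG.
elim: s s_gt0 => // x [|y s] IHs _; first by rewrite !big_seq1.
by rewrite big_cons IHs // [in RHS]big_cons -addn_maxr.
Qed.

Lemma qrank_and B C : qrank (FAnd B C) = maxn (qrank B) (qrank C).
Proof. by rewrite /qrank /= big_cat. Qed.

Lemma qrank_or B C : qrank (FOr B C) = maxn (qrank B) (qrank C).
Proof. by rewrite /qrank /= big_cat. Qed.

Lemma qrank_neg B : qrank (FNeg B) = qrank B.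
Proof. by rewrite /qrank /= big_map; apply: eq_bigr => w _; rewrite size_map. Qed.

Lemma qrank_ex x B : qrank (FEx x B) = (qrank B).+1.
Proof.
by rewrite /qrank /= big_map (@bigmax_map_succ _ _ _ size 1) ?nest_gt0.
Qed.

Lemma qrank_all x B : qrank (FAll x B) = (qrank B).+1.
Proof.
by rewrite /qrank /= big_map (@bigmax_map_succ _ _ _ size 1) ?nest_gt0.
Qed.

Lemma qrank_adj x y : qrank (FAdj x y) = 0.
Proof. by rewrite /qrank big_seq1. Qed.

Lemma qrank_eq x y : qrank (FEq x y) = 0.
Proof. by rewrite /qrank big_seq1. Qed.

Definition qrankE := (qrank_and, qrank_or, qrank_neg, qrank_ex, qrank_all,
  qrank_adj, qrank_eq).

Lemma word_alt_map_qswap w : word_alt (map qswap w) = word_alt w.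
Proof. by elim: w => //= q [|r w] //= ->; case: q; case: r. Qed.

(** [blk q] counts alternations as if [A] stood under the quantifier [q]. Unlike [alt] it obeys a
    structural recursion, and for formulas in negation normal form membership in Phi amounts to
    [blk QEx A <= 1]. *)
Lemma blkE q A : blk q A = \max_(w <- nest A) word_alt (q :: w).
Proof.
elim: A q => [x y|x y|B IH|B IHB C IHC|B IHB C IHC|x B IH|x B IH] q /=.
- by rewrite big_seq1.
- by rewrite big_seq1.
- rewrite IH big_map; apply: eq_bigr => w _.
  by rewrite -(word_alt_map_qswap (_ :: w)) /=; case: q.
- by rewrite big_cat IHB IHC.
- by rewrite big_cat IHB IHC.
- rewrite big_map IH -(@bigmax_map_succ _ _ (fun w => word_alt (q :: QEx :: w))) //.
    exact: nest_gt0.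
  by case: q.
- rewrite big_map IH -(@bigmax_map_succ _ _ (fun w => word_alt (q :: QAll :: w))) //.
    exact: nest_gt0.
  by case: q.
Qed.

Lemma alt_le_blk q A : alt A <= blk q A.
Proof.
rewrite blkE /alt; elim: (nest A) => [|w s IHs]; first by rewrite !big_nil.
rewrite !big_cons geq_max !leq_max; apply/andP; split; last by rewrite IHs orbT.
by case: w => // r w /=; rewrite leq_addl.
Qed.

Lemma word_alt_leq_alt A i :
  i < size (nest A) -> word_alt (nth [::] (nest A) i) <= alt A.
Proof.
move=> lt_i; rewrite /alt (big_nth [::]) big_mkord.
exact: (@leq_bigmax _ (fun j : 'I_(size (nest A)) => word_alt (nth [::] (nest A) j))
  (Ordinal lt_i)).
Qed.

(** The prefix [QEx] adds at most one alternation to a word without any, and adds none to a word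
    that already starts with [QEx]. *)
Lemma in_Phi_blk A : in_Phi A -> blk QEx A <= 1.
Proof.
case=> _ altA; rewrite blkE (big_nth [::]) big_mkord.
apply/bigmax_leqP => -[i lt_i] _; have /= := word_alt_leq_alt lt_i.
case: altA => [-> | [alt1 exA]].
  by case: (nth _ _ _) => //= q w; rewrite leqn0 => /eqP ->; case: q.
move: (exA i lt_i); rewrite alt1; case: (nth _ _ _) => //= q w ex1.
case: q ex1 => /= ex1; rewrite ?add0n // leq_eqVlt => /orP[/eqP|].
  by case/ex1.
by rewrite ltnS leqn0 => /eqP ->.
Qed.

(** * Graphs defined by sentences of Phi are small *)

Lemma sat_ext (V : Type) (E : V -> V -> Prop) A (a b : nat -> V) :
  (forall x, x \in fv A -> a x = b x) -> sat E a A <-> sat E b A.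
Proof.
elim: A a b => [x y|x y|B IH|B IHB C IHC|B IHB C IHC|x B IH|x B IH] a b /= ab.
- by rewrite !ab ?inE ?eqxx ?orbT.
- by rewrite !ab ?inE ?eqxx ?orbT.
- by rewrite (IH a b).
- by rewrite (IHB a b) ?(IHC a b) // => z zB; apply: ab; rewrite mem_cat zB ?orbT.
- by rewrite (IHB a b) ?(IHC a b) // => z zB; apply: ab; rewrite mem_cat zB ?orbT.
- have ab' v z : z \in fv B -> upd a x v z = upd b x v z.
    by move=> zB; rewrite /upd; case: eqVneq => // zx; apply: ab; rewrite mem_filter zx.
  by split=> -[v satB]; exists v; move: satB; rewrite (IH _ _ (ab' v)).
- have ab' v z : z \in fv B -> upd a x v z = upd b x v z.
    by move=> zB; rewrite /upd; case: eqVneq => // zx; apply: ab; rewrite mem_filter zx.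
  by split=> satB v; move: (satB v); rewrite (IH _ _ (ab' v)).
Qed.

Fixpoint Tp (M k : nat) : finType :=
  if k is k'.+1 then {set Tp M k'}
  else ({set 'I_M * 'I_M} * {set 'I_M * 'I_M})%type.

Section Types.
Variables (V : finType) (e : rel V) (M : nat).

(* Ehrenfeucht-Fraisse type of a tuple [s 0, ..., s (M - 1)]; a quantifier with [k] more
   quantifiers below it writes its value in slot [k], so the live slots are those [>= k]. *)
Fixpoint tp (k : nat) (s : nat -> V) : Tp M k :=
  match k return Tp M k with
  | 0 => ([set p : 'I_M * 'I_M | s p.1 == s p.2], [set p : 'I_M * 'I_M | e (s p.1) (s p.2)])
  | k'.+1 => [set tp k' (upd s k' v) | v in [set: V]]
  end.

(** The back-and-forth property: every move in one tuple has an answer in the other. *)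
Lemma tp_succ k s t v :
  tp k.+1 s = tp k.+1 t -> exists w, tp k (upd s k v) = tp k (upd t k w).
Proof.
move=> /= /setP/(_ (tp k (upd s k v))); rewrite imset_f ?inE // => /esym/imsetP[w _ ->].
by exists w.
Qed.

Lemma tp_atom k s t i j : tp k s = tp k t -> k <= i < M -> k <= j < M ->
  (s i == s j) = (t i == t j) /\ e (s i) (s j) = e (t i) (t j).
Proof.
elim: k s t => [|k IHk] s t.
  case=> /setP eqs /setP edg /= iM jM.
  by move: (eqs (Ordinal iM, Ordinal jM)) (edg (Ordinal iM, Ordinal jM)); rewrite !inE.
(* The move is arbitrary: it overwrites slot [k] only, which lies below the live slots [i] and
   [j]. *)
move=> /(tp_succ (s 0))[w /IHk tpk] ki kj.
have updE l u x : k < l < M -> upd u k x l = u l :> V by rewrite /upd => ?; rewrite ifN //; lia.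
move: tpk; rewrite !updE //; apply; lia.
Qed.

(** [rho] sends variables to slots. The bound variable goes to slot [k], while all other free
    variables of the body sit above [k]; the update disturbs none of them, even when a name is bound
    repeatedly. *)
Lemma upd_slot k x (l : seq nat) (a b s t : nat -> V) (rho : nat -> nat) :
  k < M ->
  (forall z, z \in [seq y <- l | y != x] ->
    [/\ k < rho z < M, a z = s (rho z) & b z = t (rho z)]) ->
  forall v w z, z \in l ->
    [/\ k <= upd rho x k z < M, upd a x v z = upd s k v (upd rho x k z)
      & upd b x w z = upd t k w (upd rho x k z)].
Proof.
move=> kM ab v w z zl; rewrite /upd; case: eqVneq => [_|zx].
  by rewrite eqxx; split=> //; lia.
have [|rz -> ->] := ab z; first by rewrite mem_filter zx.
have -> : (rho z == k) = false by apply/eqP; lia.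
by split=> //; lia.
Qed.

Lemma tp_sat k A (a b s t : nat -> V) (rho : nat -> nat) :
  qrank A <= k -> k <= M ->
  (forall x, x \in fv A -> [/\ k <= rho x < M, a x = s (rho x) & b x = t (rho x)]) ->
  tp k s = tp k t -> sat e a A <-> sat e b A.
Proof.
elim: A k a b s t rho => [x y|x y|B IH|B IHB C IHC|B IHB C IHC|x B IH|x B IH] k a b s t rho;
  rewrite ?qrankE ?geq_max /= => rkA kM ab tpst.
- have [|rx -> ->] := ab x; rewrite ?inE ?eqxx //.
  have [|ry -> ->] := ab y; rewrite ?inE ?eqxx ?orbT //.
  by have [_ ->] := tp_atom tpst rx ry.
- have [|rx -> ->] := ab x; rewrite ?inE ?eqxx //.
  have [|ry -> ->] := ab y; rewrite ?inE ?eqxx ?orbT //.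
  have [eqE _] := tp_atom tpst rx ry.
  by split=> /eqP; [rewrite eqE | rewrite -eqE] => /eqP.
- by rewrite (IH k a b s t rho).
- case/andP: rkA => rB rC; rewrite (IHB k a b s t rho) ?(IHC k a b s t rho) // => z zB;
    by apply: ab; rewrite mem_cat zB ?orbT.
- case/andP: rkA => rB rC; rewrite (IHB k a b s t rho) ?(IHC k a b s t rho) // => z zB;
    by apply: ab; rewrite mem_cat zB ?orbT.
- case: k rkA kM ab tpst => // k rB kM ab tpst; have ab' := upd_slot kM ab.
  split=> -[v satB].
    have [w tpvw] := tp_succ v tpst; exists w.
    by rewrite -(IH k _ _ _ _ _ rB _ (ab' v w)) //; lia.
  have [w tpvw] := tp_succ v (esym tpst); exists w.
  by rewrite (IH k _ _ _ _ _ rB _ (ab' w v)) //; lia.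
- case: k rkA kM ab tpst => // k rB kM ab tpst; have ab' := upd_slot kM ab.
  split=> satB v.
    have [w tpvw] := tp_succ v (esym tpst).
    by rewrite -(IH k _ _ _ _ _ rB _ (ab' w v)) //; lia.
  have [w tpvw] := tp_succ v tpst.
  by rewrite (IH k _ _ _ _ _ rB _ (ab' v w)) //; lia.
Qed.

(** [s 0] is a junk value for types that no vertex realises. *)
Definition rep (k : nat) (s : nat -> V) (tau : Tp M k) : V :=
  odflt (s 0) [pick v | tp k (upd s k v) == tau].

Lemma repP k s v : tp k (upd s k (rep s (tp k (upd s k v)))) = tp k (upd s k v).
Proof. by rewrite /rep; case: pickP => [w /eqP // | /(_ v)]; rewrite eqxx. Qed.

(** The tree of all ways to fill the slots below [k] with representatives. It branches over all
    conceivable types, realised or not, so that its size depends on [M] and [k] alone. *)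
Fixpoint wits (k : nat) (s : nat -> V) : seq V :=
  if k is k'.+1 then flatten [seq wits k' (upd s k' (rep s tau)) | tau <- enum (Tp M k')]
  else [seq s i | i <- iota 0 M].

Lemma mem_wits k s i : k <= i < M -> s i \in wits k s.
Proof.
elim: k s => [|k IHk] s ki /=; first by apply: map_f; rewrite mem_iota; lia.
(* Live slots survive on every branch; the type of an actual vertex shows that there is a branch. *)
apply/flattenP; exists (wits k (upd s k (rep s (tp k (upd s k (s 0)))))).
  by apply/mapP; eexists; first rewrite mem_enum.
have := IHk (upd s k (rep s (tp k (upd s k (s 0))))).
rewrite {1}/upd ifN; last by lia.
by apply; lia.
Qed.

Lemma wits_succ k s v : {subset wits k (upd s k (rep s (tp k (upd s k v)))) <= wits k.+1 s}.
Proof.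
move=> x xW; apply/flattenP; eexists; last exact: xW.
by apply/mapP; eexists; first rewrite mem_enum.
Qed.

Lemma size_wits k s : size (wits k s) = M * \prod_(i < k) #|Tp M i|.
Proof.
elim: k s => [|k IHk] s /=; first by rewrite big_ord0 size_map size_iota muln1.
rewrite size_flatten /shape -map_comp sumnE big_map.
under eq_bigr => tau _ do rewrite /= IHk.
by rewrite big_enum /= sum_nat_const big_ord_recr /= mulnC mulnA.
Qed.

Variable Y : {set V}.
Let eY (u v : {x | x \in Y}) : Prop := e (val u) (val v).

(** The condition [blk QAll A = 0] excludes existential quantifiers. Literals are absolute for
    induced subgraphs, and a universal quantifier has fewer instances there. *)
Lemma univ_sub A (a : nat -> V) (b : nat -> {x | x \in Y}) :
  nnf A -> blk QAll A = 0 -> (forall x, x \in fv A -> a x = val (b x)) ->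
  sat e a A -> sat eY b A.
Proof.
elim: A a b => [x y|x y|B IH|B IHB C IHC|B IHB C IHC|x B IH|x B IH] a b /=.
- by move=> _ _ ab; rewrite !ab ?inE ?eqxx ?orbT.
- by move=> _ _ ab; rewrite !ab ?inE ?eqxx ?orbT // => /val_inj.
- case: B IH => //= x y _ _ _ ab; rewrite !ab ?inE ?eqxx ?orbT // => nxy.
  by move/(congr1 val).
- case/andP=> nB nC blk0 ab [sB sC].
  split; [apply: IHB sB | apply: IHC sC] => //; try lia.
    by move=> z zB; apply: ab; rewrite mem_cat zB ?orbT.
  by move=> z zB; apply: ab; rewrite mem_cat zB ?orbT.
- case/andP=> nB nC blk0 ab [sB|sC]; [left; apply: IHB sB | right; apply: IHC sC] => //; try lia.
    by move=> z zB; apply: ab; rewrite mem_cat zB ?orbT.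
  by move=> z zB; apply: ab; rewrite mem_cat zB ?orbT.
- by [].
- move=> nB blk0 ab sB v; apply: IH (sB (val v)) => // z zB.
  by rewrite /upd; case: eqVneq => // zx; apply: ab; rewrite mem_filter zx.
Qed.

(** The tuple [s] consists of the witnesses chosen so far, which lie in [Y]. An existential
    quantifier extends it by a representative; as soon as a universal one is met, the rest is
    universal and passes to the subgraph. *)
Lemma sigma2_sub A k (a s : nat -> V) (b : nat -> {x | x \in Y}) (rho : nat -> nat) :
  nnf A -> blk QEx A <= 1 -> qrank A <= k -> k <= M ->
  (forall x, x \in fv A -> [/\ k <= rho x < M, a x = s (rho x) & a x = val (b x)]) ->
  {subset wits k s <= Y} -> sat e a A -> sat eY b A.
Proof.
elim: A k a s b rho => [x y|x y|B IH|B IHB C IHC|B IHB C IHC|x B IH|x B IH] k a s b rho;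
  rewrite ?qrankE.
- by move=> n1 b1 _ _ ab _; apply: univ_sub => // z /ab[].
- by move=> n1 b1 _ _ ab _; apply: univ_sub => // z /ab[].
- move=> n1 b1 _ _ ab _; apply: univ_sub => // [|z /ab[] //].
  by case: B n1 {IH b1 ab}.
- move=> /= /andP[nB nC]; rewrite !geq_max => /andP[bB bC] /andP[rB rC] kM ab WY [sB sC].
  split; [apply: (IHB k a s b rho) sB | apply: (IHC k a s b rho) sC] => //;
    by move=> z zB; apply: ab; rewrite mem_cat zB ?orbT.
- move=> /= /andP[nB nC]; rewrite !geq_max => /andP[bB bC] /andP[rB rC] kM ab WY [sB|sC].
    left; apply: (IHB k a s b rho) sB => //.
    by move=> z zB; apply: ab; rewrite mem_cat zB ?orbT.
  right; apply: (IHC k a s b rho) sC => //.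
  by move=> z zB; apply: ab; rewrite mem_cat zB ?orbT.
- case: k => // k nB; rewrite [blk _ _]/= add0n => bB rB kM ab WY [v sB].
  have ab' w : forall z, z \in fv B ->
    [/\ k <= upd rho x k z < M, upd a x w z = upd s k w (upd rho x k z)
      & z != x -> a z = val (b z)].
    move=> z zB; rewrite /upd; case: eqVneq => [_|zx]; first by rewrite eqxx; split=> //; lia.
    have [|rz az bz] := ab z; first by rewrite /= mem_filter zx.
    have -> : (rho z == k) = false by apply/eqP; lia.
    by split=> //; lia.
  (* The given witness [v] may lie outside [Y]. Its representative lies in [Y] and, having the same
     type of depth [k], satisfies [B] as well. *)
  set w := rep s (tp k (upd s k v)).
  have wY : w \in Y.
    apply/WY/(wits_succ (v := v)); rewrite -/w.
    have := @mem_wits k (upd s k w) k; rewrite {1}/upd eqxx; apply; lia.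
  have kM' : k <= M by lia.
  have sBw : sat e (upd a x w) B.
    rewrite (tp_sat (k := k) (s := upd s k w) (t := upd s k v) (b := upd a x v)
              (rho := upd rho x k)) //; last exact: repP.
    by move=> z zB; have [? ? ?] := ab' w z zB; have [_ ? _] := ab' v z zB.
  exists (exist _ w wY).
  apply: (IH k _ (upd s k w) _ (upd rho x k) nB bB rB kM' _ _ sBw).
    move=> z zB; have [h1 h2 h3] := ab' w z zB; split=> //.
    by rewrite /upd; case: eqVneq h3 => //= _ ->.
  by move=> u uW; apply/WY/(wits_succ (v := v)).
(* The single alternation allowed is spent on this quantifier, so no existential one occurs below
   it. *)
- move=> nA bA _ _ ab _; apply: univ_sub => //; first by move: bA => /=; lia.
  by move=> z /ab[].
Qed.

End Types.

(** * Counting types *)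

Definition tower (k n : nat) : nat := iter k (expn 4) n.

Lemma leq_tower k m n : m <= n -> tower k m <= tower k n.
Proof. by elim: k => //= k IHk /IHk; rewrite leq_exp2l. Qed.

Lemma leq_towerS k n : n <= tower k n.
Proof.
elim: k => //= k /leq_trans; apply; apply: ltnW; exact: ltn_expl.
Qed.

Lemma card_set (T : finType) : #|{: {set T}}| = 2 ^ #|T|.
Proof. by rewrite -[RHS](congr1 (expn 2) (cardsT T)) -card_powerset powersetT cardsT. Qed.

Lemma card_Tp M k : #|Tp M k| <= tower k (4 ^ (M * M)).
Proof.
elim: k => [|k IHk] /=.
  by rewrite card_prod !card_set !card_prod !card_ord -expnMn.
rewrite card_set -(expnM 2 2) leq_exp2l //.
by apply: leq_trans IHk _; rewrite leq_pmull.
Qed.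

(** Base 4 instead of 2 pays for the product: if [u] bounds the product so far and the next factor,
    then [u * u <= 2 ^ u * 2 ^ u = 4 ^ u], the next storey of the tower. *)
Lemma prod_card_Tp M k : M * \prod_(i < k) #|Tp M i| <= tower k (4 ^ (M * M)).
Proof.
elim: k => [|k IHk].
  by rewrite big_ord0 muln1 /=; have := ltn_expl (M * M) (isT : 1 < 4); nia.
rewrite big_ord_recr /= mulnA.
set u := tower _ _ in IHk *.
apply: (@leq_trans (u * u)); first by apply: leq_mul => //; exact: card_Tp.
apply: (@leq_trans (2 ^ u * 2 ^ u)); first by apply: leq_mul; apply/ltnW/ltn_expl.
by rewrite -expnMn.
Qed.

(** With [M = n.+1] slots, [tower n (4 ^ (M * M))] is at most [tower n (4 ^ (4 ^ M))]; the two
    additional storeys make this a pure tower, which is easy to compute recursively. *)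
Definition size_bound (n : nat) : nat := tower n.+2 n.+1.

Lemma leq_size_bound : {homo size_bound : m n / m <= n}.
Proof.
move=> m n mn; rewrite /size_bound -(subnK mn) /tower -!addnS iterD.
apply: leq_trans (leq_towerS _ _) _; apply: (leq_tower (n - m)).
apply: (leq_tower m.+2); lia.
Qed.

Lemma leq_sqr4 n : n * n <= 4 ^ n.
Proof. by rewrite -[4]/(2 * 2) expnMn leq_mul // ltnW // ltn_expl. Qed.

Lemma card_defines_Phi (T : finType) (e : rel T) A :
  symmetric e -> irreflexive e -> 0 < #|T| -> in_Phi A -> defines e A ->
  #|T| <= size_bound (qrank A).
Proof.
move=> symE irrE /card_gt0P[v0 _] phiA [sentA [satA onlyA]].
(* One slot more than the rank: slot [n] stays live and holds [v0], so that [Y] is nonempty, as the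
   vertex set of a graph must be. *)
set n := qrank A; pose W := wits e n.+1 n (fun=> v0).
pose Y : {set T} := [set x in W].
have v0Y : v0 \in Y.
  by rewrite inE; apply: (@mem_wits _ e n.+1 n (fun=> v0) n); rewrite leqnn ltnSn.
pose eY (u v : {x | x \in Y}) : Prop := e (val u) (val v).
have eY_sym u v : eY u v -> eY v u by rewrite /eY symE.
have eY_irr u : ~ eY u u by rewrite /eY irrE.
pose H := Graph eY_sym eY_irr (inhabits (exist _ v0 v0Y)).
have [a|f [bij_f _]] := onlyA H.
  apply: (sigma2_sub (e := e) (M := n.+1) (k := n) (a := fun=> v0) (s := fun=> v0)
    (rho := fun=> n)) => //; [by case: phiA | exact: in_Phi_blk | | ].
    by move=> x; move: sentA; rewrite /sentence => /nilP ->.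
  by move=> x xW; rewrite inE.
rewrite -(bij_eq_card bij_f) card_sig (eq_card (B := mem Y)); last by move=> x; rewrite inE.
apply: leq_trans (_ : size W <= _); first by rewrite cardsE card_size.
rewrite size_wits; apply: leq_trans (prod_card_Tp _ _) _.
rewrite /size_bound (_ : tower n.+2 n.+1 = tower n (tower 2 n.+1)); last first.
  by rewrite /tower -iterD addn2.
by apply: leq_tower; rewrite /= leq_exp2l // leq_sqr4.
Qed.

(** * Every finite graph is definable in Phi *)

Lemma word_alt_leq_blk q A i :
  i < size (nest A) -> word_alt (q :: nth [::] (nest A) i) <= blk q A.
Proof.
move=> lt_i; rewrite blkE (big_nth [::]) big_mkord.
exact: (@leq_bigmax _ (fun j : 'I_(size (nest A)) => word_alt (q :: nth [::] (nest A) j))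
  (Ordinal lt_i)).
Qed.

(** A word with one alternation that began with [QAll] would acquire a second one from the prefix
    [QEx]. *)
Lemma blk_in_Phi A : nnf A -> blk QEx A <= 1 -> in_Phi A.
Proof.
move=> nA b1; split=> //.
have := leq_trans (alt_le_blk QEx A) b1.
rewrite leq_eqVlt ltnS leqn0 => /orP[/eqP alt1|/eqP alt0]; last by left.
right; split=> // i lt_i; rewrite alt1 => w1.
have := leq_trans (word_alt_leq_blk QEx lt_i) b1.
case: (nth _ _ _) w1 => // -[] w; first by exists w.
by rewrite /= => ->.
Qed.

(** Enlarging [D] at binders, instead of filtering a list, reduces closedness to arithmetic
    conditions on variables. *)
Fixpoint fv_in (D : pred nat) (A : form) : bool :=
  match A with
  | FAdj x y | FEq x y => D x && D y
  | FNeg B => fv_in D B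
  | FAnd B C | FOr B C => fv_in D B && fv_in D C
  | FEx x B | FAll x B => fv_in (fun y => (y == x) || D y) B
  end.

Lemma fv_inE D A : fv_in D A = all D (fv A).
Proof.
elim: A D => [x y|x y|B IH|B IHB C IHC|B IHB C IHC|x B IH|x B IH] D /=.
- by rewrite andbT.
- by rewrite andbT.
- exact: IH.
- by rewrite all_cat IHB IHC.
- by rewrite all_cat IHB IHC.
- by rewrite all_filter IH; apply: eq_all => y /=; case: eqP.
- by rewrite all_filter IH; apply: eq_all => y /=; case: eqP.
Qed.

Lemma fv_in_sentence A : fv_in pred0 A -> sentence A.
Proof. by rewrite fv_inE /sentence; case: (fv A). Qed.

Lemma sub_fv_in (D D' : pred nat) A : subpred D D' -> fv_in D A -> fv_in D' A.
Proof. by move=> DD'; rewrite !fv_inE; apply: sub_all. Qed.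

(** The range includes [n], so it is never empty; the language has no constant for truth. *)
Fixpoint bigand (F : nat -> form) (n : nat) : form :=
  if n is n'.+1 then FAnd (bigand F n') (F n) else F 0.
Fixpoint bigor (F : nat -> form) (n : nat) : form :=
  if n is n'.+1 then FOr (bigor F n') (F n) else F 0.

Section Big.
Variables (F : nat -> form).

Lemma sat_bigand (V : Type) (E : V -> V -> Prop) a n :
  sat E a (bigand F n) <-> forall i, i <= n -> sat E a (F i).
Proof.
elim: n => [|n IHn] /=; first by split=> [? i|]; [rewrite leqn0 => /eqP -> | apply].
rewrite IHn; split=> [[satn satSn] i|satn]; last by split=> [i ?|]; apply: satn; lia.
by rewrite leq_eqVlt ltnS => /orP[/eqP ->|/satn].
Qed.

Lemma sat_bigor (V : Type) (E : V -> V -> Prop) a n :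
  sat E a (bigor F n) <-> exists2 i, i <= n & sat E a (F i).
Proof.
elim: n => [|n IHn] /=.
  by split=> [?|[i]]; [exists 0 | rewrite leqn0 => /eqP ->].
rewrite IHn; split=> [[[i lein sati]|sati]|[i]]; [exists i => //; lia | by exists n.+1 |].
by rewrite leq_eqVlt ltnS => /orP[/eqP ->|]; [right | left; exists i].
Qed.

Lemma nnf_bigand n : (forall i, i <= n -> nnf (F i)) -> nnf (bigand F n).
Proof. by elim: n => /= [|n IHn] nF; rewrite ?nF ?IHn // => i ?; apply: nF; lia. Qed.

Lemma nnf_bigor n : (forall i, i <= n -> nnf (F i)) -> nnf (bigor F n).
Proof. by elim: n => /= [|n IHn] nF; rewrite ?nF ?IHn // => i ?; apply: nF; lia. Qed.

Lemma fv_in_bigand D n : (forall i, i <= n -> fv_in D (F i)) -> fv_in D (bigand F n).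
Proof. by elim: n => /= [|n IHn] nF; rewrite ?nF ?IHn // => i ?; apply: nF; lia. Qed.

Lemma fv_in_bigor D n : (forall i, i <= n -> fv_in D (F i)) -> fv_in D (bigor F n).
Proof. by elim: n => /= [|n IHn] nF; rewrite ?nF ?IHn // => i ?; apply: nF; lia. Qed.

Lemma blk_bigand q k n : (forall i, i <= n -> blk q (F i) <= k) -> blk q (bigand F n) <= k.
Proof.
elim: n => /= [|n IHn] bF; first exact: bF.
by rewrite geq_max bF ?IHn // => i ?; apply: bF; lia.
Qed.

Lemma blk_bigor q k n : (forall i, i <= n -> blk q (F i) <= k) -> blk q (bigor F n) <= k.
Proof.
elim: n => /= [|n IHn] bF; first exact: bF.
by rewrite geq_max bF ?IHn // => i ?; apply: bF; lia.
Qed.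

Lemma qrank_bigor k n : (forall i, i <= n -> qrank (F i) <= k) -> qrank (bigor F n) <= k.
Proof.
elim: n => [|n IHn] bF; first exact: bF.
by rewrite qrankE geq_max bF ?IHn // => i ?; apply: bF; lia.
Qed.

End Big.

Definition exs (l : seq nat) (A : form) : form := foldr FEx A l.

Lemma sat_exs (V : Type) (E : V -> V -> Prop) a l A :
  sat E a (exs l A) <->
  exists2 b, (forall x, x \notin l -> b x = a x) & sat E b A.
Proof.
elim: l a => [|x l IHl] a /=.
  split=> [satA|[b ba satA]]; first by exists a.
  by apply: (proj2 (sat_ext _ _)) satA => x _; rewrite ba.
split=> [[v /IHl[b ba satA]]|[b ba satA]].
  exists b => // y; rewrite in_cons negb_or => /andP[yx yl].
  by rewrite ba // /upd (negPf yx).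
exists (b x); apply/IHl; exists b => // y yl; rewrite /upd; case: eqVneq => [-> //|yx].
by rewrite ba // in_cons negb_or yx.
Qed.

Lemma nnf_exs l A : nnf (exs l A) = nnf A.
Proof. by elim: l. Qed.

Lemma blk_exs l A : blk QEx (exs l A) = blk QEx A.
Proof. by elim: l. Qed.

Lemma qrank_exs l A : qrank (exs l A) = size l + qrank A.
Proof. by elim: l => //= x l IHl; rewrite qrankE IHl. Qed.

Lemma fv_in_exs D l A : fv_in (fun y => (y \in l) || D y) A -> fv_in D (exs l A).
Proof.
elim: l D => [|x l IHl] D fvA; first exact: fvA.
apply: IHl; apply: sub_fv_in fvA => y; rewrite in_cons.
by rewrite -orbA orbCA.
Qed.

Lemma sentence_exs l A : fv_in (mem l) A -> sentence (exs l A).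
Proof.
move=> fvA; apply/fv_in_sentence/fv_in_exs; apply: sub_fv_in fvA => x /= xl.
by rewrite orbF.
Qed.

Lemma iso_finP (H : graph) (T : finType) (e : rel T) (g : T -> gV H) :
  injective g -> (forall v, exists t, g t = v) ->
  (forall s t, gE (g s) (g t) <-> e s t) -> iso_fin H e.
Proof.
move=> g_inj g_surj ge.
pose f v := proj1_sig (constructive_indefinite_description _ (g_surj v)).
have gf v : g (f v) = v by rewrite /f; case: constructive_indefinite_description.
exists f; split; last by move=> u v; rewrite -ge !gf.
by exists g => // t; apply: g_inj; rewrite gf.
Qed.

Section Diagram.
Variables (T : finType) (e : rel T) (t0 : T).
Hypotheses (symE : symmetric e) (irrE : irreflexive e).
Let n := #|T|.-1.
Let v (i : nat) : T := nth t0 (enum T) i.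

Definition diagram_lit (i j : nat) : form :=
  if i == j then FEq i i
  else FAnd (FNeg (FEq i j)) (if e (v i) (v j) then FAdj i j else FNeg (FAdj i j)).

(** Variable [i <= n] names the vertex [v i], and variable [n.+1] serves for the clause that there
    are no further vertices. The shape is exists-forall, as Phi demands. *)
Definition diagram : form :=
  exs (iota 0 n.+1) (FAnd (bigand (fun i => bigand (diagram_lit i) n) n)
    (FAll n.+1 (bigor (fun i => FEq n.+1 i) n))).

Let card_T : #|T| = n.+1.
Proof. by rewrite /n prednK //; apply/card_gt0P; exists t0. Qed.

Let v_index t : v (index t (enum T)) = t.
Proof. by rewrite /v nth_index ?mem_enum. Qed.

Let index_le t : index t (enum T) <= n.
Proof. by rewrite -ltnS -card_T cardE index_mem mem_enum. Qed.

Let index_v i : i <= n -> index (v i) (enum T) = i.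
Proof. by move=> ?; rewrite /v index_uniq ?enum_uniq // -cardE card_T. Qed.

(** The literals are silent about loops, hence the restriction to [s != t]; irreflexivity of the
    graphs supplies the diagonal later. *)
Lemma sat_diagram (V : Type) (E : V -> V -> Prop) (a : nat -> V) :
  sat E a diagram <-> exists g : T -> V,
    [/\ injective g, forall w, exists t, g t = w &
     forall s t, s != t -> E (g s) (g t) <-> e s t].
Proof.
rewrite sat_exs; split=> [[b _ /= [/sat_bigand lit onto]]|[g [g_inj g_surj ge]]].
  exists (fun t => b (index t (enum T))).
  have lits s t : s != t -> b (index s (enum T)) <> b (index t (enum T)) /\
      (E (b (index s (enum T))) (b (index t (enum T))) <-> e s t).
    move=> st; have := lit _ (index_le s) => /sat_bigand/(_ _ (index_le t)).
    have -> : diagram_lit (index s (enum T)) (index t (enum T)) =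
        FAnd (FNeg (FEq (index s (enum T)) (index t (enum T))))
          (if e s t then FAdj (index s (enum T)) (index t (enum T))
           else FNeg (FAdj (index s (enum T)) (index t (enum T)))).
      rewrite /diagram_lit !v_index ifN //; apply: contra st => /eqP/(congr1 v).
      by rewrite !v_index => ->.
    by case: (e s t) => -[].
  split=> [s t bst|w|s t /lits[] //].
  - by case: (eqVneq s t) => // /lits[].
  - have /sat_bigor[i lein] := onto w.
    rewrite /= /upd eqxx (ltn_eqF (_ : i < n.+1)) // => ->.
    by exists (v i); rewrite index_v.
exists (fun i => if i <= n then g (v i) else a i).
  by move=> x; rewrite mem_iota => xn; case: leqP => // ?; exfalso; lia.
split.
  apply/sat_bigand => i lein; apply/sat_bigand => j lejn; rewrite /diagram_lit.
  case: eqVneq => //= ij; rewrite lein lejn.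
  have vij : v i != v j by rewrite /v nth_uniq ?enum_uniq // -cardE card_T.
  split; first by move/g_inj/eqP; rewrite (negPf vij).
  by case: ifP => [|/negP] eij /=; rewrite lein lejn ge.
move=> w; apply/sat_bigor; have [t <-] := g_surj w.
exists (index t (enum T)) => //=.
by rewrite /upd eqxx ltn_eqF ?ltnS // index_le v_index.
Qed.

Lemma defines_diagram : defines e diagram.
Proof.
split; [|split].
- apply: sentence_exs; apply: (@sub_fv_in (fun i => i <= n)) => [i lein|].
    by have : i \in iota 0 n.+1 by rewrite mem_iota.
  rewrite [fv_in _ _]/=; apply/andP; split.
    apply: fv_in_bigand => i lein; apply: fv_in_bigand => j lejn.
    rewrite /diagram_lit; case: ifP => _; first by rewrite /= lein.
    by case: ifP => _; rewrite /= lein lejn.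
  by apply: fv_in_bigor => i lein; rewrite /= eqxx lein orbT.
- by move=> a; apply/sat_diagram; exists id; split=> // w; exists w.
- move=> H satH; have [h] := gV_inh H.
  have /sat_diagram[g [g_inj g_surj ge]] := satH (fun=> h).
  apply: iso_finP g_inj g_surj _ => s t.
  case: (eqVneq s t) => [<-|/ge //]; rewrite irrE; split=> // /gE_irr //.
Qed.

Lemma in_Phi_diagram : in_Phi diagram.
Proof.
apply: blk_in_Phi; rewrite ?nnf_exs ?blk_exs /=.
  apply/andP; split; last exact: nnf_bigor.
  apply: nnf_bigand => i _; apply: nnf_bigand => j _.
  by rewrite /diagram_lit; do 2 case: ifP => //= _.
rewrite geq_max; apply/andP; split.
  apply: blk_bigand => i _; apply: blk_bigand => j _.
  by rewrite /diagram_lit; do 2 case: ifP => //= _.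
by rewrite -[X in _ <= X]addn0 leq_add2l; apply: blk_bigor.
Qed.

End Diagram.

(** * Register machines *)

(** Jumps are relative, so that a block of code behaves alike wherever it is placed; [runs] relies
    on this when it quantifies over the surrounding code. *)
Inductive instr : Type :=
| IZero (i : nat)
| IInc (i : nat)
| ICopy (i j : nat)
| IJeq (i j d : nat)
| IBack (d : nat).

Definition store := nat -> nat.

(** The default [IBack 0] idles, so a configuration whose counter has left the code is a fixed
    point. *)
Definition step (code : seq instr) (c : nat * store) : nat * store :=
  let: (pc, r) := c in
  match nth (IBack 0) code pc with
  | IZero i => (pc.+1, upd r i 0)
  | IInc i => (pc.+1, upd r i (r i).+1)
  | ICopy i j => (pc.+1, upd r i (r j))
  | IJeq i j d => (if r i == r j then pc + d else pc.+1, r)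
  | IBack d => (pc - d, r)
  end.

Definition reach code c c' := exists n, iter n (step code) c = c'.

Lemma reach_trans code c1 c2 c3 : reach code c1 c2 -> reach code c2 c3 -> reach code c1 c3.
Proof. by case=> m <- [n <-]; exists (n + m); rewrite iterD. Qed.

Definition runs (s : seq instr) (r r' : store) : Prop :=
  forall pre post, reach (pre ++ s ++ post) (size pre, r) (size pre + size s, r').

Lemma runs_nil r : runs [::] r r.
Proof. by move=> pre post; exists 0; rewrite addn0. Qed.

Lemma runs_cat s1 s2 r1 r2 r3 : runs s1 r1 r2 -> runs s2 r2 r3 -> runs (s1 ++ s2) r1 r3.
Proof.
move=> run1 run2 pre post; rewrite -catA.
apply: reach_trans (run1 pre (s2 ++ post)) _.
by have := run2 (pre ++ s1) post; rewrite !size_cat -!catA addnA.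
Qed.

Lemma step_at pre ins post r :
  step (pre ++ ins :: post) (size pre, r) =
  match ins with
  | IZero i => ((size pre).+1, upd r i 0)
  | IInc i => ((size pre).+1, upd r i (r i).+1)
  | ICopy i j => ((size pre).+1, upd r i (r j))
  | IJeq i j d => (if r i == r j then size pre + d else (size pre).+1, r)
  | IBack d => (size pre - d, r)
  end.
Proof. by rewrite /step nth_cat ltnn subnn. Qed.

Lemma runs_zero i r : runs [:: IZero i] r (upd r i 0).
Proof. by move=> pre post; exists 1; rewrite addn1; apply: (step_at pre (IZero i)). Qed.

Lemma runs_inc i r : runs [:: IInc i] r (upd r i (r i).+1).
Proof. by move=> pre post; exists 1; rewrite addn1; apply: (step_at pre (IInc i)). Qed.

Lemma runs_copy i j r : runs [:: ICopy i j] r (upd r i (r j)).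
Proof. by move=> pre post; exists 1; rewrite addn1; apply: (step_at pre (ICopy i j)). Qed.

(** The forward offset skips the test, the body and the closing jump; the closing jump leads back to
    the test. *)
Definition while_neq (x y : nat) (B : seq instr) : seq instr :=
  IJeq x y (size B).+2 :: rcons B (IBack (size B).+1).

Lemma while_neq_exit x y B r : r x = r y -> runs (while_neq x y B) r r.
Proof.
move=> rxy pre post; exists 1; rewrite /= size_rcons.
by apply: etrans (step_at pre (IJeq x y _) _ _) _; rewrite rxy eqxx.
Qed.

Lemma while_neq_loop x y B r1 r2 r3 : r1 x != r1 y -> runs B r1 r2 ->
  runs (while_neq x y B) r2 r3 -> runs (while_neq x y B) r1 r3.
Proof.
move=> rxy runB runW pre post.
apply: (@reach_trans _ _ ((size pre).+1, r1)).
  by exists 1; apply: etrans (step_at pre (IJeq x y _) _ _) _; rewrite (negPf rxy).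
apply: (@reach_trans _ _ ((size pre).+1 + size B, r2)).
  have := runB (rcons pre (IJeq x y (size B).+2)) (IBack (size B).+1 :: post).
  by rewrite /while_neq size_rcons /= cat_rcons cat_rcons.
apply: reach_trans (runW pre post); exists 1.
have -> : pre ++ while_neq x y B ++ post =
    (pre ++ IJeq x y (size B).+2 :: B) ++ IBack (size B).+1 :: post.
  by rewrite /while_neq -catA /= cat_rcons.
have -> : (size pre).+1 + size B = size (pre ++ IJeq x y (size B).+2 :: B).
  by rewrite size_cat /=; lia.
by apply: etrans (step_at _ (IBack _) _ _) _; rewrite size_cat /=; congr pair; lia.
Qed.

(* Code computing [p] from the registers [xs] into [out], with scratch registers [>= b]. *)
Fixpoint compile (p : rfun) (xs : seq nat) (out b : nat) : seq instr :=
  match p with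
  | RZero => [:: IZero out]
  | RSucc => [:: ICopy out (head 0 xs); IInc out]
  | RProj i => [:: ICopy out (nth 0 xs i)]
  | RComp g hs =>
      (fix compiles gs o := if gs is h :: gs' then
         compile h xs o (b + size hs) ++ compiles gs' o.+1 else [::]) hs b
      ++ compile g (iota b (size hs)) out (b + size hs)
  | RPrec g h =>
      compile g (behead xs) b b.+3 ++ IZero b.+1 ::
      while_neq b.+1 (head 0 xs)
        (compile h [:: b.+1, b & behead xs] b.+2 b.+3 ++ [:: ICopy b b.+2; IInc b.+1])
      ++ [:: ICopy out b]
  | RMin g =>
      [:: IZero b; IZero b.+1] ++ compile g (b :: xs) b.+2 b.+3 ++
      while_neq b.+2 b.+1 (IInc b :: compile g (b :: xs) b.+2 b.+3)
      ++ [:: ICopy out b]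
  end.

(** A named copy of the inner fixpoint of [compile], convertible to it, where [b] already lies
    beyond the temporaries. *)
Definition compiles (xs : seq nat) (b : nat) :=
  fix compiles (gs : seq rfun) (o : nat) : seq instr :=
    if gs is h :: gs' then compile h xs o b ++ compiles gs' o.+1 else [::].

(** The constructor [RComp] nests [rfun] inside a list, and the generated induction principle gives
    no hypothesis for the members of that list. *)
Fixpoint rfun_nested_ind (P : rfun -> Prop) (PZero : P RZero) (PSucc : P RSucc)
    (PProj : forall i, P (RProj i))
    (PComp : forall g hs, P g -> foldr (fun h Q => P h /\ Q) True hs -> P (RComp g hs))
    (PPrec : forall g h, P g -> P h -> P (RPrec g h))
    (PMin : forall g, P g -> P (RMin g)) (p : rfun) {struct p} : P p :=
  let rec := rfun_nested_ind PZero PSucc PProj PComp PPrec PMin in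
  match p with
  | RZero => PZero
  | RSucc => PSucc
  | RProj i => PProj i
  | RComp g hs => PComp g hs (rec g)
      ((fix recs hs : foldr (fun h Q => P h /\ Q) True hs :=
          if hs is h :: hs' then conj (rec h) (recs hs') else I) hs)
  | RPrec g h => PPrec g h (rec g) (rec h)
  | RMin g => PMin g (rec g)
  end.

(** The register [out] may be one of the inputs; recursion and minimisation therefore work on
    scratch registers and copy the result at the end. *)
Definition compile_correct (p : rfun) : Prop :=
  forall vs y, reval p vs y -> forall xs out b r,
  all (fun i => i < b) xs -> map r xs = vs -> out < b ->
  exists r', [/\ runs (compile p xs out b) r r', r' out = y
    & forall i, i < b -> i != out -> r' i = r i].

(** Inputs lie below [o] and results are stored from [o] upwards, so each computation preserves the
    inputs and all earlier results. *)
Lemma compiles_correct hs : foldr (fun h Q => compile_correct h /\ Q) True hs ->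
  forall vs ys, reval_list hs vs ys -> forall xs o b r,
  all (fun i => i < o) xs -> map r xs = vs -> o + size hs <= b ->
  exists r', [/\ runs (compiles xs b hs o) r r', map r' (iota o (size hs)) = ys
    & forall i, i < o -> r' i = r i].
Proof.
elim: hs => [|h hs IHhs] /=.
  move=> _ vs ys ev xs o b r _ _ _; inversion ev.
  by exists r; split=> //; apply: runs_nil.
case=> corr_h corr_hs vs ys ev; inversion ev as [|h' hs' vs' y ys' ev_h ev_hs]; subst.
move=> xs o b r xso rxs ob.
have lt_ob : o < b by lia.
have xsb : all (fun i => i < b) xs by apply: sub_all xso => i /=; lia.
have [r1 [run1 r1o r1E]] := corr_h _ _ ev_h xs o b r xsb rxs lt_ob.
have r1xs : map r1 xs = vs.
  rewrite -rxs; apply/eq_in_map => i /(allP xso) /= io.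
  by apply: r1E; [lia | rewrite neq_ltn io].
have xso1 : all (fun i => i < o.+1) xs by apply: sub_all xso => i /=; lia.
have ob1 : o.+1 + size hs <= b by lia.
have [r2 [run2 r2o r2E]] := IHhs corr_hs _ _ ev_hs xs o.+1 b r1 xso1 r1xs ob1.
exists r2; split; first exact: runs_cat run1 run2.
  by rewrite r2o r2E // r1o.
by move=> i io; rewrite r2E ?r1E //; lia.
Qed.

(** The intermediate values hidden in the derivation become a function, which the loop invariant can
    refer to. *)
Lemma prec_iterates g h x vs y : reval (RPrec g h) (x :: vs) y ->
  exists a : nat -> nat, [/\ reval g vs (a 0),
    forall k, k < x -> reval h [:: k, a k & vs] (a k.+1) & a x = y].
Proof.
elim: x y => [|x IHx] y ev.
  by inversion ev; subst; exists (fun=> y).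
inversion ev as [| | | |  |g' h' x' vs' r y' ev_r ev_h|]; subst.
have [a [a0 aS ax]] := IHx _ ev_r.
exists (upd a x.+1 y); split=> [|k lt_k|]; rewrite /upd ?eqxx //.
rewrite ltn_eqF // eqSS; case: eqVneq => [->|kx]; first by rewrite ax.
by apply: aS; lia.
Qed.

Lemma compile_prec_correct g h :
  compile_correct g -> compile_correct h -> compile_correct (RPrec g h).
Proof.
move=> corr_g corr_h vs y ev [|x xs] out b r xsb rxs outb.
  by rewrite -rxs in ev; inversion ev.
case: vs rxs ev => // v vs [rx rxs] /prec_iterates[a [ev_g ev_h ax]].
move: xsb => /= /andP[xb xsb].
have xsb3 : all (fun i => i < b.+3) xs by apply: sub_all xsb => i /=; lia.
have keep (r' : store) : (forall i, i < b -> r' i = r i) -> map r' xs = vs /\ r' x = v.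
  move=> r'E; rewrite r'E // rx; split=> //; rewrite -rxs; apply/eq_in_map => i.
  by move/(allP xsb)/r'E.
have [r1 [run1 r1b r1E]] := corr_g _ _ ev_g xs b b.+3 r xsb3 rxs (ltac:(lia)).
set B := compile h [:: b.+1, b & xs] b.+2 b.+3 ++ [:: ICopy b b.+2; IInc b.+1].
(* Register [b.+1] counts the rounds [k] and [b] holds the iterate [a k]; the induction is on the
   number [d] of rounds left. *)
have loop d k r2 : k + d = v -> r2 b.+1 = k -> r2 b = a k ->
    (forall i, i < b -> r2 i = r i) ->
    exists r3, [/\ runs (while_neq b.+1 x B) r2 r3, r3 b = a v
      & forall i, i < b -> r3 i = r i].
  elim: d k r2 => [|d IHd] k r2 kd r2c r2a r2E; have [r2xs r2x] := keep r2 r2E.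
    exists r2; split=> //; last by rewrite r2a; congr a; lia.
    by apply: while_neq_exit; rewrite r2c r2x; lia.
  have lt_kv : k < v by lia.
  have args3 : all (fun i => i < b.+3) [:: b.+1, b & xs].
    by rewrite /= xsb3 andbT; lia.
  have r2args : map r2 [:: b.+1, b & xs] = [:: k, a k & vs].
    by rewrite /= r2c r2a r2xs.
  have [r3 [run3 r3t r3E]] := corr_h _ _ (ev_h k lt_kv) _ b.+2 b.+3 r2 args3 r2args (ltac:(lia)).
  pose r4 := upd r3 b (r3 b.+2); pose r5 := upd r4 b.+1 (r4 b.+1).+1.
  have r4c : r4 b.+1 = k by rewrite /r4 /upd ifN ?r3E ?r2c //; lia.
  have [||||r6 [run6 r6b r6E]] := IHd k.+1 r5.
  - by lia.
  - by rewrite /r5 /upd eqxx r4c.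
  - by rewrite /r5 /r4 /upd ifN ?eqxx //; lia.
  - move=> i ib; rewrite /r5 /r4 /upd !ifN ?r3E ?r2E //; lia.
  exists r6; split=> //; apply: while_neq_loop run6.
    by rewrite r2c r2x; lia.
  by apply: runs_cat run3 _; apply: (runs_cat (runs_copy _ _ _) (runs_inc _ _)).
pose r2 := upd r1 b.+1 0.
have [||||r3 [run3 r3b r3E]] := loop v 0 r2.
- by [].
- by rewrite /r2 /upd eqxx.
- by rewrite /r2 /upd ifN //; lia.
- by move=> i ib; rewrite /r2 /upd ifN ?r1E //; lia.
exists (upd r3 out (r3 b)); split.
- apply: runs_cat run1 _; rewrite -cat1s.
  by apply: (runs_cat (runs_zero _ _)); apply: runs_cat run3 _; apply: runs_copy.
- by rewrite /upd eqxx r3b.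
- by move=> i ib io; rewrite /upd ifN // r3E.
Qed.

Lemma compile_min_correct g : compile_correct g -> compile_correct (RMin g).
Proof.
move=> corr_g vs n ev xs out b r xsb rxs outb.
inversion ev as [| | | | | |g' vs' n' ev_n ev_lt]; subst g' vs' n'.
have args3 : all (fun i => i < b.+3) (b :: xs).
  by rewrite /= ltnW //; apply: sub_all xsb => i /=; lia.
(* Register [b] holds the candidate, [b.+1] a constant zero to compare with, and [b.+2] the value of
   [g], which among candidates up to [n] vanishes at [n] only. *)
have test k r1 : k <= n -> r1 b = k -> r1 b.+1 = 0 -> (forall i, i < b -> r1 i = r i) ->
    exists r2, [/\ runs (compile g (b :: xs) b.+2 b.+3) r1 r2, (r2 b.+2 == 0) = (k == n),
      r2 b = k /\ r2 b.+1 = 0 & forall i, i < b -> r2 i = r i].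
  move=> kn r1b r1z r1E.
  have r1args : map r1 (b :: xs) = k :: vs.
    rewrite /= r1b -rxs; congr cons; apply/eq_in_map => i; by move/(allP xsb)/r1E.
  have [t ev_t t0] : exists2 t, reval g (k :: vs) t & (t == 0) = (k == n).
    move: kn; rewrite leq_eqVlt => /orP[/eqP ->|lt_kn]; first by exists 0; rewrite ?eqxx.
    by have [t ?] := ev_lt k lt_kn; exists t.+1 => //; rewrite (ltn_eqF lt_kn).
  have [r2 [run2 r2t r2E]] := corr_g _ _ ev_t _ b.+2 b.+3 r1 args3 r1args (ltac:(lia)).
  exists r2; split=> //; first by rewrite r2t.
    by rewrite !r2E ?r1b ?r1z //; lia.
  by move=> i ib; rewrite r2E ?r1E //; lia.
have loop d k r1 : k + d = n -> (r1 b.+2 == 0) = (k == n) -> r1 b = k /\ r1 b.+1 = 0 ->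
    (forall i, i < b -> r1 i = r i) ->
    exists r2, [/\ runs (while_neq b.+2 b.+1 (IInc b :: compile g (b :: xs) b.+2 b.+3)) r1 r2,
      r2 b = n & forall i, i < b -> r2 i = r i].
  elim: d k r1 => [|d IHd] k r1 kd r1t [r1b r1z] r1E.
    exists r1; split=> //; last by lia.
    by apply: while_neq_exit; rewrite r1z; apply/eqP; rewrite r1t; lia.
  pose r2 := upd r1 b (r1 b).+1.
  have [||||r3 [run3 r3t r3b r3E]] := test k.+1 r2.
  - by lia.
  - by rewrite /r2 /upd eqxx r1b.
  - by rewrite /r2 /upd ifN //; lia.
  - by move=> i ib; rewrite /r2 /upd ifN ?r1E //; lia.
  have [||||r4 [run4 r4b r4E]] := IHd k.+1 r3 => //; first by lia.
  exists r4; split=> //; apply: while_neq_loop run4.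
    by rewrite r1z r1t; lia.
  by rewrite -cat1s; apply: runs_cat run3; apply: runs_inc.
pose r1 := upd (upd r b 0) b.+1 0.
have [||||r2 [run2 r2t r2b r2E]] := test 0 r1 => //.
- by rewrite /r1 /upd ifN ?eqxx //; lia.
- by rewrite /r1 /upd eqxx.
- by move=> i ib; rewrite /r1 /upd !ifN //; lia.
have [||||r3 [run3 r3b r3E]] := loop n 0 r2 => //.
exists (upd r3 out (r3 b)); split.
- rewrite [compile _ _ _ _]/= -cat1s -[IZero b.+1 :: _]cat1s.
  apply: (runs_cat (runs_zero _ _)); apply: (runs_cat (runs_zero _ _)).
  by apply: runs_cat run2 _; apply: runs_cat run3 _; apply: runs_copy.
- by rewrite /upd eqxx r3b.
- by move=> i ib io; rewrite /upd ifN // r3E.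
Qed.

Lemma compileP p : compile_correct p.
Proof.
elim/rfun_nested_ind: p => [||i|g hs corr_g corr_hs|g h|g]; last 2 first.
- exact: compile_prec_correct.
- exact: compile_min_correct.
- move=> vs y ev xs out b r _ _ _; inversion ev; subst.
  exists (upd r out 0); split; [exact: runs_zero | by rewrite /upd eqxx |].
  by move=> i _ io; rewrite /upd ifN.
- move=> vs y ev [|x xs] out b r _ rxs _; rewrite -rxs in ev; inversion ev.
  exists (upd (upd r out (r x)) out (upd r out (r x) out).+1); split.
  + by apply: (runs_cat (runs_copy _ _ _) (runs_inc _ _)).
  + by rewrite /upd !eqxx.
  + by move=> i _ io; rewrite /upd !ifN.
- move=> vs y ev xs out b r _ rxs _; rewrite -rxs in ev.
  inversion ev as [| |i' vs' lt_i| | | |].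
  exists (upd r out (r (nth 0 xs i))); split; first exact: runs_copy.
    by rewrite /upd eqxx (nth_map 0) // -(size_map r).
  by move=> j _ jo; rewrite /upd ifN.
- move=> vs y ev xs out b r xsb rxs outb.
  inversion ev as [| | |g' hs' vs' ys y' ev_hs ev_g| | |]; subst g' hs' vs' y'.
  have [r1 [run1 r1ys r1E]] := compiles_correct corr_hs ev_hs xsb rxs (leqnn (b + size hs)).
  have tmps : all (fun i => i < b + size hs) (iota b (size hs)).
    by apply/allP => i; rewrite mem_iota => /andP[].
  have [r2 [run2 r2o r2E]] := corr_g _ _ ev_g _ out _ r1 tmps r1ys (ltac:(lia)).
  exists r2; split=> //; first exact: runs_cat run1 run2.
  by move=> i ib io; rewrite r2E ?r1E //; lia.
Qed.

(** * Halting runs *)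

(* In state [s] a machine jumps to [d1] or [d2], where [jmp s = ((i, j), (d1, d2))], according
   to whether registers [i] and [j] agree, and it puts into register [k] the number [0] if
   [src s k = None] and the content of register [j], plus one if [c], if [src s k = Some (j, c)]. *)
Record machine := Machine {
  jmp : nat -> (nat * nat) * (nat * nat);
  src : nat -> nat -> option (nat * bool) }.

(** The states are [0, ..., S] with [S] halting, and [run_lt] makes [N] the first halting time. *)
Record halting_run (L S N : nat) (M : machine) (st : nat -> nat) (reg : nat -> nat -> nat) :
    Prop := HaltingRun {
  run_jmp : forall s, s < S -> [/\ (jmp M s).1.1 < L, (jmp M s).1.2 < L,
    (jmp M s).2.1 <= S & (jmp M s).2.2 <= S];
  run_src : forall s k j c, s < S -> k < L -> src M s k = Some (j, c) -> j < L;
  run_st0 : st 0 = 0;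
  run_reg0 : forall k, k < L -> reg 0 k = 0;
  run_lt : forall t, t < N -> st t < S;
  run_stS : forall t, t < N ->
    st t.+1 = if reg t (jmp M (st t)).1.1 == reg t (jmp M (st t)).1.2
              then (jmp M (st t)).2.1 else (jmp M (st t)).2.2;
  run_regS : forall t k, t < N -> k < L ->
    reg t.+1 k = if src M (st t) k is Some (j, c) then reg t j + c else 0;
  run_halt : st N = S }.

(** This lets register contents be represented by time points of the same run, so that one sort of
    elements suffices for times and numbers. *)
Lemma run_reg_le L S N M st reg (run : halting_run L S N M st reg) t k :
  t <= N -> k < L -> reg t k <= t.
Proof.
elim: t k => [|t IHt] k tN kL; first by rewrite (run_reg0 run).
rewrite (run_regS run) //; case Esrc: src => [[j c]|] //.
have := IHt j (ltnW tN) (run_src run (run_lt run tN) kL Esrc).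
by case: c {Esrc}; lia.
Qed.

Definition ireg (ins : instr) : nat :=
  match ins with
  | IZero i | IInc i => i.+1
  | ICopy i j | IJeq i j _ => (maxn i j).+1
  | IBack _ => 0
  end.

Lemma ireg_bound code : exists L, all (fun ins => ireg ins <= L) code.
Proof.
elim: code => [|ins code [L codeL]]; first by exists 0.
exists (maxn (ireg ins) L); rewrite /= leq_maxl /=.
by apply: sub_all codeL => ins' le; rewrite leq_max le orbT.
Qed.

(** Instructions without a test become comparisons of register 0 with itself with equal targets, so
    that all states obey one scheme. Forward jumps are cut off at [size code], the halting state. *)
Definition machine_of (code : seq instr) : machine := Machine
  (fun s => match nth (IBack 0) code s with
    | IJeq i j d => ((i, j), (minn (size code) (s + d), minn (size code) s.+1))
    | IBack d => ((0, 0), (s - d, s - d))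
    | _ => ((0, 0), (s.+1, s.+1))
    end)
  (fun s k => match nth (IBack 0) code s with
    | IZero i => if k == i then None else Some (k, false)
    | IInc i => Some (k, k == i)
    | ICopy i j => Some (if k == i then j else k, false)
    | _ => Some (k, false)
    end).

Section Code.
Variables (L : nat) (code : seq instr).
Hypotheses (L_gt0 : 0 < L) (codeL : all (fun ins => ireg ins <= L) code).

Let conf (t : nat) : nat * store := iter t (step code) (0, fun=> 0).

Let confS t : conf t.+1 = step code (conf t).
Proof. by []. Qed.

(** The counter may leave the code before time [n]. The first such time is taken for [N]; the
    configuration is fixed from then on, so the registers at [N] are those at [n]. *)
Lemma halting_run_of n r : iter n (step code) (0, fun=> 0) = (size code, r) ->
  exists N st reg, halting_run L (size code) N (machine_of code) st reg /\ reg N =1 r.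
Proof.
move=> conf_n.
have exN : exists N, size code <= (conf N).1 by exists n; rewrite /conf conf_n.
case: (ex_minnP exN) => N haltN minN.
have lt_pc t : t < N -> (conf t).1 < size code.
  by move=> tN; rewrite ltnNge; apply/negP => /minN; lia.
exists N, (fun t => minn (size code) (conf t).1), (fun t => (conf t).2); split.
  split.
  - move=> s lt_s /=; have := all_nthP (IBack 0) codeL s lt_s.
    by case: (nth _ _ _) => //= *; split; lia.
  - move=> s k j c lt_s kL /=; have := all_nthP (IBack 0) codeL s lt_s.
    case: (nth _ _ _) => [i|i|i i'|i i' d|d] //=; try by move=> _ [<-].
    + by case: eqP => // _ _ [<-].
    + by case: eqP => // _ leL [<-]; lia.
  - by rewrite minn0.
  - by [].
  - by move=> t /lt_pc; lia.
  - move=> t tN; have pct := lt_pc t tN; rewrite (minn_idPr (ltnW pct)).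
    rewrite confS; move: pct; case: (conf t) => pc s /= lt_pc'.
    case: (nth _ _ _) => [i|i|i i'|i i' d|d] /=; rewrite ?eqxx; try lia.
    by case: eqP.
  - move=> t k tN kL; have pct := lt_pc t tN; rewrite (minn_idPr (ltnW pct)).
    rewrite confS; move: pct; case: (conf t) => pc s /= lt_pc'.
    case: (nth _ _ _) => [i|i|i i'|i i' d|d] /=; rewrite /upd ?addn0 //.
    + by case: eqP => //=; rewrite addn0.
    + by case: eqP => [->|] /=; rewrite ?addn0 ?addn1.
    + by case: eqP.
  - by apply/minn_idPl.
have le_Nn : N <= n by apply: minN; rewrite /conf conf_n.
have fixN d : conf (d + N) = conf N.
  elim: d => // d IHd; rewrite addSn confS IHd.
  by move: haltN; case: (conf N) => pc s /= ?; rewrite nth_default // subn0.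
by move: (fixN (n - N)); rewrite subnK // /conf conf_n => <-.
Qed.

End Code.

Lemma runs_nseq_inc x r : exists r', [/\ runs (nseq x (IInc 0)) r r', r' 0 = r 0 + x
  & forall i, i != 0 -> r' i = r i].
Proof.
elim: x r => [|x IHx] r; first by exists r; split=> //; [exact: runs_nil | rewrite addn0].
have [r' [run r'0 r'E]] := IHx (upd r 0 (r 0).+1).
exists r'; split; first by rewrite [nseq _ _]/= -cat1s; apply: runs_cat run; apply: runs_inc.
  by rewrite r'0 /upd /= addSnnS.
by move=> i i0; rewrite r'E // /upd (negPf i0).
Qed.

(** A register never exceeds the elapsed time, so producing the output [y] takes at least [y] steps.
    Only the [x] leading increments depend on the input. *)
Lemma halting_run_rfun p : exists L C, forall x y, reval p [:: x] y ->
  exists N M st reg, halting_run L (x + C) N M st reg /\ y <= N.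
Proof.
have [L codeL] := ireg_bound (compile p [:: 0] 1 2).
exists L.+2, (size (compile p [:: 0] 1 2)) => x y ev.
have [r1 [run1 r10 r1E]] := runs_nseq_inc x (fun=> 0).
have [|r2 [run2 r2y _]] := compileP ev (isT : all (fun i => i < 2) [:: 0]) (r := r1) _
  (isT : 1 < 2); first by rewrite /= r10.
have [n conf_n] := runs_cat run1 run2 [::] [::].
rewrite cats0 /= add0n in conf_n.
have codeL2 : all (fun ins => ireg ins <= L.+2) (nseq x (IInc 0) ++ compile p [:: 0] 1 2).
  rewrite all_cat all_nseq orbT /=; apply: sub_all codeL => ins; lia.
have [N [st [reg [run regN]]]] := halting_run_of (ltn0Sn _) codeL2 conf_n.
rewrite size_cat size_nseq in run.
exists N, (machine_of (nseq x (IInc 0) ++ compile p [:: 0] 1 2)), st, reg; split=> //.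
by rewrite -r2y -regN (run_reg_le run).
Qed.

(** * Properties pinning down a halting run *)

Section Run.
Variables (L S N : nat) (M : machine) (st : nat -> nat) (reg : nat -> nat -> nat).
Hypothesis run : halting_run L S N M st reg.

(* Relation [0] is the successor, [1] the order; relation [vi k] maps a time to the content of
   register [k], and [qi s] is the diagonal of the set of times at which the state is [s]. *)
Definition vi (k : nat) : nat := k.+2.
Definition qi (s : nat) : nat := (L + s).+2.

Definition run_rel (j a b : nat) : bool :=
  match j with
  | 0 => b == a.+1
  | 1 => a <= b
  | k.+2 => if k < L then reg a k == b else (a == b) && (st a == k - L)
  end.

Lemma run_rel_vi k a b : k < L -> run_rel (vi k) a b = (reg a k == b).
Proof. by rewrite /= => ->. Qed.

Lemma run_rel_qi s a b : run_rel (qi s) a b = (a == b) && (st a == s).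
Proof. by rewrite /= ltnNge leq_addr /= addnC addnK. Qed.

(** The order enters only through a least element, the absence of gaps between an element and its
    successor, and maximality of halting times; along the finite chain of the run this determines
    it. *)
Record run_axioms (X : Type) (D : X -> Prop) (R : nat -> X -> X -> Prop) (z : X) : Prop :=
  PinsRun {
  ax_zero : D z;
  ax_least : forall a, D a -> R 1 z a;
  ax_between : forall a b u, R 0 a b -> R 1 a u -> u = a \/ R 1 b u;
  ax_max : forall a u, R (qi S) a a -> R 1 a u -> a = u;
  ax_halt : forall a u, R (qi S) a a -> ~ R 0 a u;
  ax_next : forall a, D a -> R (qi S) a a \/ exists b, R 0 a b;
  ax_pred0 : forall a, ~ R 0 a z;
  ax_succ_inj : forall a a' b, R 0 a b -> R 0 a' b -> a = a';
  ax_fun : forall j, j <= qi S -> j != 1 -> forall a b b', R j a b -> R j a b' -> b = b';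
  ax_diag : forall s, s <= S -> forall a b, R (qi s) a b -> a = b;
  ax_excl : forall s, s <= S -> forall s', s' <= S -> s != s' ->
    forall a, R (qi s) a a -> ~ R (qi s') a a;
  ax_st0 : R (qi 0) z z;
  ax_reg0 : forall k, k < L -> R (vi k) z z;
  ax_jmp : forall s, s < S -> forall a b u w, R 0 a b -> R (qi s) a a ->
    R (vi (jmp M s).1.1) a u -> R (vi (jmp M s).1.2) a w ->
    u = w /\ R (qi (jmp M s).2.1) b b \/ u <> w /\ R (qi (jmp M s).2.2) b b;
  ax_src : forall s, s < S -> forall k, k < L -> forall a b, R 0 a b -> R (qi s) a a ->
    match src M s k with
    | None => R (vi k) b z
    | Some (j, false) => forall u, R (vi j) a u -> R (vi k) b u
    | Some (j, true) => forall u w, R (vi j) a u -> R 0 u w -> R (vi k) b w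
    end }.

Record embeds (X : Type) (D : X -> Prop) (R : nat -> X -> X -> Prop) (zs : nat -> X) : Prop :=
  Embeds {
  emb_inj : forall a b, a <= N -> b <= N -> zs a = zs b -> a = b;
  emb_dom : forall v, D v <-> exists2 a, a <= N & v = zs a;
  emb_rel : forall j, j <= qi S -> forall v w, R j v w <->
    exists a b, [/\ a <= N, b <= N, v = zs a, w = zs b & run_rel j a b] }.

Let stS t : t <= N -> st t <= S.
Proof.
by rewrite leq_eqVlt => /orP[/eqP ->|/(run_lt run)/ltnW //]; rewrite (run_halt run).
Qed.

Let regN t k : t <= N -> k < L -> reg t k <= N.
Proof. by move=> tN kL; apply: leq_trans (run_reg_le run tN kL) tN. Qed.

Let vi_le k : k < L -> vi k <= qi S.
Proof. by rewrite /vi /qi; lia. Qed.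

Let qi_le s : s <= S -> qi s <= qi S.
Proof. by rewrite /qi; lia. Qed.

Section Embeds.
Variables (X : Type) (D : X -> Prop) (R : nat -> X -> X -> Prop) (zs : nat -> X).
Hypothesis emb : embeds D R zs.

Let relE j a b : j <= qi S -> a <= N -> b <= N -> R j (zs a) (zs b) <-> run_rel j a b.
Proof.
move=> jS aN bN; rewrite (emb_rel emb jS); split=> [[a' [b' [a'N b'N]]]|]; last by exists a, b.
by move=> /(emb_inj emb aN a'N) <- /(emb_inj emb bN b'N) <-.
Qed.

Let relD j v w : j <= qi S -> R j v w ->
  exists a b, [/\ a <= N, b <= N, v = zs a, w = zs b & run_rel j a b].
Proof. by move=> jS /(emb_rel emb jS). Qed.

Lemma embeds_run_axioms : run_axioms D R (zs 0).
Proof.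
split.
- by apply/(emb_dom emb); exists 0.
- by move=> _ /(emb_dom emb)[a aN ->]; apply/relE.
- move=> v w u /relD[|a [b [aN bN -> -> /= /eqP ba]]] // /relD[|a' [c [a'N cN]]] //.
  move=> /(emb_inj emb aN a'N) <- -> /= ac; case: (eqVneq a c) => [->|nac]; first by left.
  by right; apply/relE => //=; lia.
- move=> v u /relD[|a [b [aN bN -> _ ]]] //; rewrite run_rel_qi => /andP[_ /eqP stS'].
  move=> /relD[|a' [c [a'N cN]]] //.
  move=> /(emb_inj emb aN a'N) <- -> /= ac; congr zs.
  by case: (ltnP a N) => [/(run_lt run)|]; lia.
- move=> v u /relD[|a [b [aN bN -> _ ]]] //; rewrite run_rel_qi => /andP[_ /eqP stS'].
  move=> /relD[|a' [c [a'N cN]]] //.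
  move=> /(emb_inj emb aN a'N) <- _ /= /eqP ca.
  by have /(run_lt run) : a < N; lia.
- move=> _ /(emb_dom emb)[a aN ->]; move: (aN); rewrite leq_eqVlt => /orP[/eqP aN'|lt_aN].
    by left; apply/relE => //; rewrite run_rel_qi eqxx aN' (run_halt run) eqxx.
  by right; exists (zs a.+1); apply/relE => //=.
- by move=> v /relD[|a [b [aN bN _ /(emb_inj emb (leq0n _) bN) <-]]].
- move=> v v' w /relD[|a [b [aN bN -> -> /= /eqP ba]]] // /relD[|a' [b' [a'N b'N -> ]]] //.
  by move=> /(emb_inj emb bN b'N) <- /= /eqP ba'; congr zs; lia.
- move=> j jS j1 v w w' /relD[|a [b [aN bN -> -> ab]]] // /relD[|a' [b' [a'N b'N]]] //.
  move=> /(emb_inj emb aN a'N) <- -> ab'; congr zs.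
  case: j ab ab' j1 {jS} => [|[|k]] //=; first by move=> /eqP -> /eqP ->.
  case: ifP => _; first by move=> /eqP -> /eqP ->.
  by move=> /andP[/eqP <- _] /andP[/eqP <- _].
- move=> s sS v w /relD[|a [b [aN bN -> -> ]]]; first exact: qi_le.
  by rewrite run_rel_qi => /andP[/eqP ->].
- move=> s sS s' s'S ss' v /relD[|a [b [aN bN va _]]]; first exact: qi_le.
  rewrite run_rel_qi va => /andP[_ /eqP sta] /relE; rewrite run_rel_qi sta (negPf ss') andbF.
  by move=> /(_ (qi_le s'S) aN aN).
- by apply/relE => //; [apply: qi_le | rewrite run_rel_qi (run_st0 run) eqxx].
- by move=> k kL; apply/relE => //; [apply: vi_le | rewrite run_rel_vi // (run_reg0 run) ].
- move=> s sS v w u u' /relD[|a [b [aN bN -> -> /= /eqP ba]]] //.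
  have [iL jL d1S d2S] := run_jmp run sS.
  move=> /relE; rewrite run_rel_qi eqxx => /(_ (qi_le (ltnW sS)) aN aN) /= /eqP sta.
  move=> /relD[|a' [c [a'N cN]]]; first exact: vi_le.
  move=> /(emb_inj emb aN a'N) <- ->; rewrite run_rel_vi // => /eqP ac.
  move=> /relD[|a'' [c' [a''N c'N]]]; first exact: vi_le.
  move=> /(emb_inj emb aN a''N) <- ->; rewrite run_rel_vi // => /eqP ac'.
  have lt_aN : a < N by lia.
  have := run_stS run lt_aN; rewrite -ba sta ac ac'.
  case: eqVneq => [->|ncc] stb; [left | right]; split=> //.
  + by apply/relE => //; [apply: qi_le | rewrite run_rel_qi stb !eqxx].
  + by move/(emb_inj emb cN c'N)/eqP; rewrite (negPf ncc).
  + by apply/relE => //; [apply: qi_le | rewrite run_rel_qi stb !eqxx].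
- move=> s sS k kL v w /relD[|a [b [aN bN -> -> /= /eqP ba]]] //.
  move=> /relE; rewrite run_rel_qi eqxx => /(_ (qi_le (ltnW sS)) aN aN) /= /eqP sta.
  have lt_aN : a < N by lia.
  have := run_regS run lt_aN kL; rewrite -ba sta.
  case Esrc: (src M s k) => [[j []]|] regb.
  + have jL := run_src run sS kL Esrc.
    move=> u u' /relD[|a' [c [a'N cN]]]; first exact: vi_le.
    move=> /(emb_inj emb aN a'N) <- ->; rewrite run_rel_vi // => /eqP ac.
    move=> /relD[|c' [c'' [c'N c''N]]] // /(emb_inj emb cN c'N) <- -> /= /eqP cc.
    by apply/relE => //; [apply: vi_le | rewrite run_rel_vi //; lia].
  + have jL := run_src run sS kL Esrc.
    move=> u /relD[|a' [c [a'N cN]]]; first exact: vi_le.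
    move=> /(emb_inj emb aN a'N) <- ->; rewrite run_rel_vi // => /eqP ac.
    by apply/relE => //; [apply: vi_le | rewrite run_rel_vi //; lia].
  + by apply/relE => //; [apply: vi_le | rewrite run_rel_vi //; lia].
Qed.

End Embeds.

(** * Recovering the run from the axioms *)

Section Converse.
Variables (X : Type) (D : X -> Prop) (R : nat -> X -> X -> Prop) (z : X).
Hypotheses (RD : forall j a b, R j a b -> D a /\ D b) (ax : run_axioms D R z).

Let next (a : X) : X := epsilon (inhabits z) (R 0 a).
Let zs (n : nat) : X := iter n next z.

(** A coincidence can be pushed down by injectivity of the successor until it gives [z] a
    predecessor. *)
Let chain_inj n : (forall i, i < n -> R 0 (zs i) (zs i.+1)) ->
  forall i j, i <= n -> j <= n -> zs i = zs j -> i = j.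
Proof.
move=> chain; suff inj_le i j : i <= j -> j <= n -> zs i = zs j -> i = j.
  move=> i j iN jN eq_ij; case: (leqP i j) => [ij|/ltnW ji]; first exact: inj_le.
  by apply/esym/inj_le.
elim: i j => [|i IHi] [|j] // ij jn eq_ij.
  by case: (ax_pred0 ax (a := zs j)); have := chain j jn; rewrite -eq_ij.
congr _.+1; apply: IHi => //; first exact: ltnW.
apply: (ax_succ_inj ax (b := zs j.+1)); last exact: chain.
by rewrite -eq_ij; apply: chain; lia.
Qed.

(** The three claims need each other. The state at [n] is not halting, so a next point exists; the
    register contents are at most [n], hence lie on the part of the chain already known to be
    injective, and this decides the comparison made by a jump. *)
Let chain_run n : n <= N ->
  [/\ forall i, i < n -> R 0 (zs i) (zs i.+1),
    forall i, i <= n -> R (qi (st i)) (zs i) (zs i) &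
    forall i k, i <= n -> k < L -> R (vi k) (zs i) (zs (reg i k))].
Proof.
elim: n => [_|n IHn lt_nN].
  split=> [//|i|i k]; rewrite leqn0 => /eqP ->; first by rewrite (run_st0 run); apply: ax_st0 ax.
  by move=> kL; rewrite (run_reg0 run) //; apply: ax_reg0 ax _ kL.
have [chain stR regR] := IHn (ltnW lt_nN).
have lt_st := run_lt run lt_nN; have stn := stR n (leqnn n).
have chain_n : R 0 (zs n) (zs n.+1).
  have [Dn _] := RD stn; rewrite [zs n.+1]/(next (zs n)); apply: epsilon_spec.
  case: (ax_next ax Dn) => // halt_n.
  by case: (ax_excl ax (leqnn S) (ltnW lt_st) _ halt_n stn); lia.
have chainS i : i < n.+1 -> R 0 (zs i) (zs i.+1).
  by rewrite ltnS leq_eqVlt => /orP[/eqP ->|/chain].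
have [iL jL d1S d2S] := run_jmp run lt_st.
split=> // [i|i k]; rewrite leq_eqVlt => /orP[/eqP ->|]; try by [apply: stR | apply: regR].
  have := ax_jmp ax lt_st chain_n stn (regR n _ (leqnn n) iL) (regR n _ (leqnn n) jL).
  have := run_stS run lt_nN; case: eqP => [->|ne] -> [[eqz //]|[nez //]].
  have reg_le k : k < L -> reg n k <= n by apply: run_reg_le run _ _ (ltnW lt_nN).
  by case: ne; apply: (chain_inj chain) eqz; apply: reg_le.
move=> kL; have := ax_src ax lt_st kL chain_n stn.
have := run_regS run lt_nN kL; case Esrc: (src _ _ _) => [[j []]|] ->.
- have jL' := run_src run lt_st kL Esrc.
  move=> h; apply: h (regR n j (leqnn n) jL') _; rewrite addn1; apply: chainS.
  by rewrite ltnS; apply: run_reg_le run _ _ (ltnW lt_nN) jL'.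
- have jL' := run_src run lt_st kL Esrc.
  by move=> h; rewrite addn0; apply: h (regR n j (leqnn n) jL').
- by [].
Qed.

Let chainN i : i < N -> R 0 (zs i) (zs i.+1).
Proof. by have [h _ _] := chain_run (leqnn N); apply: h. Qed.

Let stR i : i <= N -> R (qi (st i)) (zs i) (zs i).
Proof. by have [_ h _] := chain_run (leqnn N); apply: h. Qed.

Let regR i k : i <= N -> k < L -> R (vi k) (zs i) (zs (reg i k)).
Proof. by have [_ _ h] := chain_run (leqnn N); apply: h. Qed.

Let zs_inj i j : i <= N -> j <= N -> zs i = zs j -> i = j.
Proof. exact: chain_inj chainN i j. Qed.

Let haltN : R (qi S) (zs N) (zs N).
Proof. by have := stR (leqnn N); rewrite (run_halt run). Qed.

(** Walking up the chain, [v] is either met or stays above the current point; nothing but [zs N]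
    itself is above the halting point. This excludes nonstandard elements. *)
Let zs_cover v : D v -> exists2 a, a <= N & v = zs a.
Proof.
move=> Dv; have: forall i, i <= N -> (exists2 a, a <= N & v = zs a) \/ R 1 (zs i) v.
  elim=> [_|i IHi lt_iN]; first by right; apply: ax_least ax _ Dv.
  case: (IHi (ltnW lt_iN)) => [|le_iv]; first by left.
  case: (ax_between ax (chainN lt_iN) le_iv) => [->|]; last by right.
  by left; exists i => //; apply: ltnW.
move=> /(_ N (leqnn N))[//|le_Nv]; exists N => //.
by rewrite (ax_max ax haltN le_Nv).
Qed.

Let zsD i : i <= N -> D (zs i).
Proof. by move=> /stR/RD[]. Qed.

Let leR i j : i <= N -> j <= N -> R 1 (zs i) (zs j) <-> i <= j.
Proof.
move=> iN jN; split=> [|ij].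
  rewrite leqNgt => le_ij; apply/negP => lt_ji.
  (* If [zs i] were below an earlier [zs j], absence of gaps would push the lower end up to [zs N],
     and maximality would give [zs N = zs j]. *)
  have [d id] : exists d, i + d = N by exists (N - i); lia.
  elim: d i id iN lt_ji le_ij => [|d IHd] i id iN lt_ji le_ij.
    have iN' : i = N by lia.
    move: le_ij; rewrite iN' => /(ax_max ax haltN)/(zs_inj (leqnn N) jN); lia.
  have lt_iN : i < N by lia.
  case: (ax_between ax (chainN lt_iN) le_ij) => [/(zs_inj jN iN)|]; first by lia.
  by apply: IHd; lia.
elim: i ij iN => [|i IHi] lt_ij lt_iN; first exact: ax_least ax _ (zsD jN).
case: (ax_between ax (chainN lt_iN) (IHi (ltnW lt_ij) (ltnW lt_iN))) => //.
by move=> /(zs_inj jN (ltnW lt_iN)); lia.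
Qed.

(** The chain provides the pairs that must be related. Functionality rules out further pairs for
    successor and registers, exclusiveness of states for the diagonal relations. *)
Lemma run_axioms_embeds : exists zs : nat -> X, embeds D R zs.
Proof.
exists zs; split=> [||j jS v w]; first exact: zs_inj.
  by move=> v; split=> [/zs_cover //|[a aN ->]]; apply: zsD.
split=> [Rvw|[a [b [aN bN -> ->]]]].
  have [/zs_cover[a aN va] /zs_cover[b bN wb]] := RD Rvw; exists a, b; split=> //.
  move: Rvw; rewrite {}va {}wb; case: j jS => [|[|k]] jS Rab /=.
  - case: (ltnP a N) => [lt_aN|leNa].
      by apply/eqP/zs_inj => //; apply: (ax_fun ax jS _ Rab (chainN lt_aN)).
    have aN' : a = N by lia.
    by case: (ax_halt ax haltN (u := zs b)); rewrite -aN'.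
  - by apply/leR.
  - case: ifP => [kL|/negbT kL].
      apply/eqP/zs_inj => //; first exact: regN.
      exact: (ax_fun ax jS _ (regR aN kL) Rab).
    have sS : k - L <= S by move: jS; rewrite /qi; lia.
    have kE : k.+2 = qi (k - L) by rewrite /qi; lia.
    rewrite kE in Rab; have ab := zs_inj aN bN (ax_diag ax sS Rab).
    rewrite -ab eqxx /=; apply: contraT => nst; rewrite -ab in Rab.
    by case: (ax_excl ax (stS aN) sS nst (stR aN) Rab).
case: j jS => [|[|k]] jS /=.
- by move=> /eqP ba; rewrite ba; apply: chainN; lia.
- by move/leR; apply.
- case: ifP => [kL /eqP <-|/negbT kL /andP[/eqP <- /eqP sta]]; first exact: regR.
  have kE : k.+2 = qi (k - L) by rewrite /qi; lia.
  by rewrite kE -sta; apply: stR.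
Qed.

End Converse.
End Run.

(** * Coding binary relations in a graph *)

Section Coding.
Variables (V : Type) (E : V -> V -> Prop) (c : nat -> V).

(* A vertex adjacent to the marker [c i] has sort [i]. Sort [0] holds the elements, each sort
   [i > 0] holds one copy of every element, and [R j a b] is an edge between the copy of [a]
   of sort [1] and the copy of [b] of sort [j.+2]. *)
Definition coded_rel (j : nat) (a b : V) : Prop :=
  exists u w, [/\ E a (c 0), E b (c 0), E u (c 1), E w (c j.+2) & [/\ E a u, E b w & E u w]].

Definition perfect (p q : nat) : Prop :=
  (forall a, E a (c p) -> exists b, E b (c q) /\ E a b) /\
  (forall a b b', E a (c p) -> E b (c q) -> E b' (c q) -> E a b -> E a b' -> b = b').

(** Sort 0 is matched perfectly with every other sort. The only edges left undetermined join sort 1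
    to the sorts from 2 on, and these carry the relations. *)
Record coded (m : nat) : Prop := Coded {
  cd_cover : forall v, exists2 i, i <= m & v = c i \/ E v (c i);
  cd_neq : forall i, i <= m -> forall j, j <= m -> i != j -> c i <> c j;
  cd_indep : forall i, i <= m -> forall j, j <= m -> ~ E (c i) (c j);
  cd_sort : forall i, i <= m -> forall j, j <= m -> i != j ->
    forall v, E v (c i) -> ~ E v (c j);
  cd_perfect : forall i, i < m -> perfect 0 i.+1 /\ perfect i.+1 0;
  cd_noedge : forall i, i <= m -> forall j, j <= m -> (i == j) || (1 < i) && (1 < j) ->
    forall u v, E u (c i) -> E v (c j) -> ~ E u v }.

Lemma coded_relD j a b : coded_rel j a b -> E a (c 0) /\ E b (c 0).
Proof. by case=> u [w []]. Qed.

End Coding.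

Section CodeGraph.
Variables (L S N : nat) (st : nat -> nat) (reg : nat -> nat -> nat).
Let m := (qi L S).+2.
Let R := run_rel L st reg.

(** [inl (a, i)] is the copy of time [a] of sort [i], and [inr i] is a marker. Relation [j] uses
    sort [j.+2] and the last relation is [qi L S], whence the value of [m]. *)
Definition code_vertex : finType := ('I_N.+1 * 'I_m.+1 + 'I_m.+1)%type.

Definition code_arc (u v : code_vertex) : bool :=
  match u, v with
  | inr i, inl (_, j) => i == j
  | inl (a, i), inl (b, j) =>
      [&& i == 0 :> nat, 0 < j & a == b] || [&& i == 1 :> nat, 1 < j & R (j - 2) a b]
  | _, _ => false
  end.

Definition code_edge (u v : code_vertex) : bool := code_arc u v || code_arc v u.

Lemma code_edge_sym : symmetric code_edge.
Proof. by move=> u v; rewrite /code_edge orbC. Qed.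

Lemma code_edge_irr : irreflexive code_edge.
Proof.
by case=> [[a i]|i]; rewrite /code_edge //=; case: i => [[|[|i]] ?] //=; rewrite !andbF.
Qed.

Lemma card_code_vertex : N < #|{: code_vertex}|.
Proof. by rewrite card_sum card_prod !card_ord; lia. Qed.

Definition marker (i : nat) : code_vertex := inr (inord i).
Definition element (a : nat) : code_vertex := inl (inord a, ord0).

Let edge_marker (v : code_vertex) i : i <= m ->
  code_edge v (marker i) <-> exists a : 'I_N.+1, v = inl (a, inord i).
Proof.
move=> im; rewrite /code_edge; case: v => [[a k]|k] /=; last by split=> // -[].
split=> [/eqP <-|[b [_ ->]]]; [by exists a | exact: eqxx].
Qed.

Let edge_ll (a b : 'I_N.+1) i j : i <= m -> j <= m ->
  code_edge (inl (a, inord i)) (inl (b, inord j)) =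
  [|| [&& i == 0, 0 < j & a == b], [&& i == 1, 1 < j & R (j - 2) a b],
      [&& j == 0, 0 < i & b == a] | [&& j == 1, 1 < i & R (i - 2) b a]].
Proof. by move=> im jm; rewrite /code_edge /= !inordK ?ltnS // -orbA. Qed.

Let edge_perfect (a b : 'I_N.+1) i : i < m ->
  code_edge (inl (a, inord 0)) (inl (b, inord i.+1)) = (a == b).
Proof. by move=> im; rewrite edge_ll //= andbF orbF. Qed.

Let edge_rel (a b : 'I_N.+1) j : j.+2 <= m ->
  code_edge (inl (a, inord 1)) (inl (b, inord j.+2)) = R j a b.
Proof. by move=> jm; rewrite edge_ll //= !subSS subn0 orbF. Qed.

Lemma coded_code_graph : coded (fun u v => code_edge u v) marker m.
Proof.
split.
- case=> [[a k]|k]; exists (val k); try exact: (leq_ord k).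
    by right; apply: (proj2 (edge_marker _ (leq_ord k))); exists a; rewrite inord_val.
  by left; rewrite /marker inord_val.
- by move=> i im j jm ij [/(congr1 val)]; rewrite /= !inordK ?ltnS // => /eqP; rewrite (negPf ij).
- by move=> i im j jm.
- move=> i im j jm ij v /(edge_marker _ im)[a ->] /(edge_marker _ jm)[b [_ /(congr1 val)]].
  by rewrite /= !inordK ?ltnS // => /eqP; rewrite (negPf ij).
- move=> i im; split; split.
  + move=> v /(edge_marker _ (leq0n _))[a ->]; exists (inl (a, inord i.+1)).
    by split; [apply: (proj2 (edge_marker _ im)); exists a | rewrite edge_perfect].
  + move=> u v w /(edge_marker _ (leq0n _))[a ->] /(edge_marker _ im)[b ->].
    move=> /(edge_marker _ im)[b' ->]; rewrite !edge_perfect //.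
    by move=> /eqP <- /eqP <-.
  + move=> v /(edge_marker _ im)[a ->]; exists (inl (a, inord 0)).
    split; first by apply: (proj2 (edge_marker _ (leq0n m))); exists a.
    by rewrite code_edge_sym edge_perfect.
  + move=> u v w /(edge_marker _ im)[a ->] /(edge_marker _ (leq0n _))[b ->].
    move=> /(edge_marker _ (leq0n _))[b' ->]; rewrite !(code_edge_sym (inl (a, _))).
    by rewrite !edge_perfect // => /eqP -> /eqP ->.
- move=> i im j jm ij u v /(edge_marker _ im)[a ->] /(edge_marker _ jm)[b ->].
  by rewrite edge_ll // => /or4P[] /and3P[]; lia.
Qed.

Lemma embeds_code_graph :
  embeds L S N st reg (fun v => code_edge v (marker 0))
    (coded_rel (fun u v => code_edge u v) marker) element.
Proof.
have ord0E : ord0 = inord 0 :> 'I_m.+1 by apply: val_inj; rewrite /= inordK.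
split.
- move=> a b aN bN [/(congr1 val)]; by rewrite /= !inordK ?ltnS.
- move=> v; rewrite edge_marker //; split=> [[a ->]|[a aN ->]].
    by exists (val a); [exact: leq_ord | rewrite /element inord_val ord0E].
  by exists (inord a); rewrite /element ord0E.
- move=> j jS v w; have jm : j.+2 <= m by rewrite /m; lia.
  split=> [[u [u' []]]|[a [b [aN bN -> -> ab]]]].
    move=> /(edge_marker _ (leq0n _))[a ->] /(edge_marker _ (leq0n _))[b ->].
    move=> /(edge_marker _ (isT : 1 <= m))[a' ->] /(edge_marker _ jm)[b' ->].
    rewrite !edge_perfect // edge_rel // => -[/eqP <- /eqP <- ab].
    exists (val a), (val b); rewrite !leq_ord /element !inord_val ord0E.
    by split.
  exists (inl (inord a, inord 1)), (inl (inord b, inord j.+2)).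
  have mk (a' : 'I_N.+1) i : i <= m -> code_edge (inl (a', inord i)) (marker i).
    by move=> im; apply: (proj2 (edge_marker _ im)); exists a'.
  rewrite /element ord0E; split; try exact: mk.
  by rewrite !edge_perfect // edge_rel // !eqxx !inordK ?ltnS.
Qed.

Section Rigid.
Variables (V : Type) (E : V -> V -> Prop) (c : nat -> V) (zs : nat -> V).
Hypotheses (symE : forall u v, E u v -> E v u) (codE : coded E c m)
  (emb : embeds L S N st reg (fun v => E v (c 0)) (coded_rel E c) zs).

Let copy (a i : nat) : V :=
  if i is 0 then zs a else epsilon (inhabits (c 0)) (fun b => E b (c i) /\ E (zs a) b).

Let zs_sort a : a <= N -> E (zs a) (c 0).
Proof. by move=> aN; apply/(emb_dom emb); exists a. Qed.

Let copyP a i : a <= N -> i < m -> E (copy a i.+1) (c i.+1) /\ E (zs a) (copy a i.+1).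
Proof.
move=> aN im; have [[ex _] _] := cd_perfect codE im.
apply: (epsilon_spec (inhabits (c 0)) (fun b => E b (c i.+1) /\ E (zs a) b)).
by apply/ex/zs_sort.
Qed.

Let copy_sort a i : a <= N -> i <= m -> E (copy a i) (c i).
Proof. by case: i => [|i] aN im; [apply: zs_sort | have [] := copyP aN im]. Qed.

Let copy_uniq a i b : a <= N -> i < m -> E b (c i.+1) -> E (zs a) b -> b = copy a i.+1.
Proof.
move=> aN im bi ab; have [ci ac] := copyP aN im.
by have [[_ uniq] _] := cd_perfect codE im; apply: (uniq (zs a)) => //; apply: zs_sort.
Qed.

Let copy_owner a b i : a <= N -> b <= N -> i < m -> E (zs b) (copy a i.+1) -> a = b.
Proof.
move=> aN bN im ba; have [ci ac] := copyP aN im.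
have [_ [_ uniq]] := cd_perfect codE im; apply: (emb_inj emb) => //.
by apply: (uniq (copy a i.+1)) => //; try exact: zs_sort; apply: symE.
Qed.

Let copy_inj a b i : a <= N -> b <= N -> i <= m -> copy a i = copy b i -> a = b.
Proof.
case: i => [|i] aN bN im; first exact: (emb_inj emb).
move=> eqc; apply: (copy_owner aN bN im); rewrite eqc.
by have [_] := copyP bN im.
Qed.

Let sort_uniq i j v : i <= m -> j <= m -> E v (c i) -> E v (c j) -> i = j.
Proof.
move=> im jm vi vj; apply/eqP; case: eqVneq => // ij.
by case: (cd_sort codE im jm ij vi).
Qed.

Let edge_copy a b i j : a <= N -> b <= N -> i <= m -> j <= m -> E (copy a i) (copy b j) <->
  [|| [&& i == 0, 0 < j & a == b], [&& i == 1, 1 < j & R (j - 2) a b],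
      [&& j == 0, 0 < i & b == a] | [&& j == 1, 1 < i & R (i - 2) b a]].
Proof.
(* By symmetry [i' <= j'] suffices, which leaves three cases: no edges allowed, a matching with sort
   0, or a relation between sorts 1 and [j']. *)
have main a' b' i' j' : a' <= N -> b' <= N -> i' <= j' -> j' <= m ->
    E (copy a' i') (copy b' j') <->
    [&& i' == 0, 0 < j' & a' == b'] || [&& i' == 1, 1 < j' & R (j' - 2) a' b'].
  move=> aN bN ij jm; have im := leq_trans ij jm.
  have [noedge|edge] := boolP ((i' == j') || (1 < i') && (1 < j')).
    split=> [|/orP[/and3P[]|/and3P[]]]; try by lia.
    by case/(cd_noedge codE im jm noedge (copy_sort aN im) (copy_sort bN jm)).
  case: j' => [|j'] in ij jm edge *; first by lia.
  case: i' => [|[|i']] in ij im edge *; last by lia.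
    rewrite /= orbF; split=> [ab|/eqP <-]; last by have [] := copyP aN jm.
    by apply/eqP/esym/(copy_owner bN aN jm).
  case: j' => [|j'] in ij jm edge *; first by lia.
  rewrite /= !subSS subn0; have jS : j' <= qi L S by move: jm; rewrite /m; lia.
  have [c1 a1] := copyP aN (isT : 0 < m); have [cj bj] := copyP bN jm.
  split=> [e1j|ab].
    have /(emb_rel emb jS)[a2 [b2 [a2N b2N]]] : coded_rel E c j' (zs a') (zs b').
      by exists (copy a' 1), (copy b' j'.+2); split=> //; apply: zs_sort.
    by move=> /(emb_inj emb aN a2N) -> /(emb_inj emb bN b2N) ->.
  have [u [w [_ _ u1 wj [au bw uw]]]] : coded_rel E c j' (zs a') (zs b').
    by apply/(emb_rel emb jS); exists a', b'.
  by move: uw; rewrite (copy_uniq aN (isT : 0 < m) u1 au) (copy_uniq bN jm wj bw).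
move=> aN bN im jm; case: (leqP i j) => [ij|/ltnW ji].
  by rewrite main //; split; [lia | case/or4P=> /and3P[? ? ?]; lia].
have -> : E (copy a i) (copy b j) <-> E (copy b j) (copy a i) by split; apply: symE.
by rewrite main //; split; [lia | case/or4P=> /and3P[? ? ?]; lia].
Qed.

(** Every vertex is a marker or belongs to a sort; the matchings make each sort a copy of sort 0,
    which [zs] enumerates, and the remaining edges are read off [coded_rel]. *)
Lemma code_graph_rigid : exists g : code_vertex -> V,
  [/\ injective g, forall v, exists t, g t = v &
   forall s t, E (g s) (g t) <-> code_edge s t].
Proof.
pose g (t : code_vertex) : V :=
  match t with inl (a, i) => copy a i | inr i => c i end.
have leN (a : 'I_N.+1) : a <= N by rewrite -ltnS.
have lem (i : 'I_m.+1) : i <= m by rewrite -ltnS.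
have marker_copy (i : 'I_m.+1) (a : 'I_N.+1) (j : 'I_m.+1) : c i <> copy a j.
  move=> cij; have := copy_sort (leN a) (lem j); rewrite -cij.
  exact: (cd_indep codE (lem i) (lem j)).
exists g; split.
- case=> [[a i]|i] [[b j]|j] //= gst.
  + have ij : i = j.
      apply/val_inj/(sort_uniq (lem i) (lem j) (copy_sort (leN a) (lem i))).
      by rewrite gst; apply: copy_sort.
    rewrite ij in gst *; congr (inl (_, _)); apply: val_inj.
    exact: copy_inj gst.
  + by case: (marker_copy j a i).
  + by case: (marker_copy i b j).
  + suff -> : i = j by [].
    by apply/eqP; case: eqVneq => // ij; case: (cd_neq codE (lem i) (lem j) ij gst).
- move=> v; have [i im [->|vi]] := cd_cover codE v.
    by exists (inr (inord i)); rewrite /= inordK.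
  case: i im vi => [|i] im vi.
    have [a aN ->] := proj1 (emb_dom emb v) vi.
    by exists (inl (inord a, inord 0)); rewrite /= !inordK.
  have [_ [ex _]] := cd_perfect codE im; have [u [u0 uv]] := ex v vi.
  have [a aN ua] := proj1 (emb_dom emb u) u0.
  exists (inl (inord a, inord i.+1)); rewrite [g _]/= !inordK //.
  by apply/esym/copy_uniq => //; rewrite -ua; apply: symE.
- case=> [[a i]|i] [[b j]|j] /=.
  + have := edge_ll a b (lem i) (lem j); rewrite !inord_val => ->.
    by apply: edge_copy.
  + rewrite /code_edge /=; split=> [e1|/eqP ->]; last exact: copy_sort.
    by apply/eqP/val_inj/(sort_uniq (lem j) (lem i) e1)/copy_sort.
  + rewrite /code_edge /= orbF; split=> [/symE e1|/eqP ->]; last by apply/symE/copy_sort.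
    by apply/eqP/val_inj/(sort_uniq (lem i) (lem j) e1)/copy_sort.
  + by split=> // e1; case: (cd_indep codE (lem i) (lem j) e1).
Qed.

End Rigid.
End CodeGraph.

(** * The sentence describing a run *)

(* Variables: [cst i] for the markers, [9] for the least element, [0, ..., 6] for the
   quantified variables of the axioms, [7] and [8] for the auxiliary variables of [relF]. *)
Definition cst (i : nat) : nat := i.+4.+4.+2.
Definition sortF (i x : nat) : form := FAdj x (cst i).
Definition impF (A B : form) : form := FOr (FNeg A) B.
(** [FEq 9 9] stands for truth; variable 9 is bound by the outer block, so the sentence stays
    closed. *)
Definition guardF (b : bool) (A : form) : form := if b then A else FEq 9 9.

Definition relF (j x y : nat) : form :=
  FEx 7 (FEx 8 (FAnd (FAnd (sortF 0 x) (FAnd (sortF 0 y) (FAnd (sortF 1 7) (sortF j.+2 8))))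
    (FAnd (FAdj x 7) (FAnd (FAdj y 8) (FAdj 7 8))))).

(** Negation normal form requires premises to be written in dual form. Being universal, they cost no
    alternation below the universal quantifiers of an axiom, while a positive [relF] makes it
    forall-exists. *)
Definition nrelF (j x y : nat) : form :=
  FAll 7 (FAll 8 (impF (sortF 0 x) (impF (sortF 0 y) (impF (sortF 1 7) (impF (sortF j.+2 8)
    (impF (FAdj x 7) (impF (FAdj y 8) (FNeg (FAdj 7 8))))))))).

Definition impR (j x y : nat) (B : form) : form := FOr (nrelF j x y) B.

Section Sat.
Variables (V : Type) (E : V -> V -> Prop).
Implicit Types (a : nat -> V) (x y j : nat) (A B : form).

Let consts (a : nat -> V) (i : nat) : V := a (cst i).

Lemma sat_or a A B (P Q : Prop) : (sat E a A <-> P) -> (sat E a B <-> Q) ->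
  sat E a (FOr A B) <-> P \/ Q.
Proof. by move=> AP BQ; rewrite /= AP BQ. Qed.

Lemma sat_impF a A B (P Q : Prop) : (sat E a A <-> P) -> (sat E a B <-> Q) ->
  sat E a (impF A B) <-> (P -> Q).
Proof. by move=> AP BQ; rewrite /= AP BQ; split; [tauto | case: (classic P); tauto]. Qed.

Lemma sat_guardF a b A (P : Prop) : (sat E a A <-> P) -> sat E a (guardF b A) <-> (b -> P).
Proof. by case: b => AP; [rewrite /= AP; split=> [//|]; apply | ]. Qed.

Lemma sat_relF a j x y : x \notin [:: 7; 8] -> y \notin [:: 7; 8] ->
  sat E a (relF j x y) <-> coded_rel E (consts a) j (a x) (a y).
Proof.
rewrite !inE !negb_or => /andP[/negPf x7 /negPf x8] /andP[/negPf y7 /negPf y8].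
rewrite /relF /sortF /coded_rel /= /upd /= x7 x8 y7 y8.
split=> -[u [w h]]; exists u, w; first by case: h => [[? [? [? ?]]] [? [? ?]]].
by case: h => ? ? ? ? [? ? ?].
Qed.

Lemma sat_all a x B (P : V -> Prop) : (forall v, sat E (upd a x v) B <-> P v) ->
  sat E a (FAll x B) <-> forall v, P v.
Proof. by move=> BP; split=> h v; apply/BP. Qed.

Lemma sat_nrelF a j x y : x \notin [:: 7; 8] -> y \notin [:: 7; 8] ->
  sat E a (nrelF j x y) <-> ~ coded_rel E (consts a) j (a x) (a y).
Proof.
rewrite !inE !negb_or => /andP[/negPf x7 /negPf x8] /andP[/negPf y7 /negPf y8].
apply: iff_trans (_ : _ <-> forall u w, E (a x) (a (cst 0)) -> E (a y) (a (cst 0)) ->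
    E u (a (cst 1)) -> E w (a (cst j.+2)) -> E (a x) u -> E (a y) w -> ~ E u w) _.
  do 2 (apply: sat_all => ?); rewrite /sortF /cst.
  by repeat apply: sat_impF; rewrite /= /upd /= ?x7 ?x8 ?y7 ?y8.
split=> [h [u [w [h1 h2 h3 h4 [h5 h6 h7]]]] | h u w h1 h2 h3 h4 h5 h6 h7].
  exact: (h u w).
by apply: h; exists u, w.
Qed.

Lemma sat_impR a j x y B (Q : Prop) : x \notin [:: 7; 8] -> y \notin [:: 7; 8] ->
  (sat E a B <-> Q) ->
  sat E a (impR j x y B) <-> (coded_rel E (consts a) j (a x) (a y) -> Q).
Proof.
move=> x78 y78 BQ; have nR := sat_nrelF a j x78 y78.
apply: iff_trans (sat_or nR BQ) _.
by split; [tauto | case: (classic Q); tauto].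
Qed.

Lemma sat_ex a x B (P : V -> Prop) : (forall v, sat E (upd a x v) B <-> P v) ->
  sat E a (FEx x B) <-> exists v, P v.
Proof. by move=> BP; split=> -[v h]; exists v; apply/BP. Qed.

Lemma sat_and a A B (P Q : Prop) : (sat E a A <-> P) -> (sat E a B <-> Q) ->
  sat E a (FAnd A B) <-> P /\ Q.
Proof. by move=> AP BQ; rewrite /= AP BQ. Qed.

Lemma sat_family a F n (P : nat -> Prop) : (forall i, sat E a (F i) <-> P i) ->
  sat E a (bigand F n) <-> forall i, i <= n -> P i.
Proof. by move=> FP; rewrite sat_bigand; split=> h i /h /FP. Qed.

End Sat.

(** Meanings are assembled along the syntax instead of unfolding [sat], so that relations surface as
    [coded_rel] and disjunctions with a dual as implications. *)
Ltac sat_step := lazymatch goal with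
  | |- sat _ _ (FAll _ _) <-> _ => apply: sat_all => ?
  | |- sat _ _ (FEx _ _) <-> _ => apply: sat_ex => ?
  | |- sat _ _ (impF _ _) <-> _ => apply: sat_impF
  | |- sat _ _ (impR _ _ _ _) <-> _ => apply: sat_impR; [exact: isT | exact: isT |]
  | |- sat _ _ (guardF _ _) <-> _ => apply: sat_guardF
  | |- sat _ _ (FOr _ _) <-> _ => apply: sat_or
  | |- sat _ _ (FAnd _ _) <-> _ => apply: sat_and
  | |- sat _ _ (relF _ _ _) <-> _ => apply: sat_relF; exact: isT
  | |- sat _ _ (nrelF _ _ _) <-> _ => apply: sat_nrelF; exact: isT
  | |- sat _ _ (bigand _ _) <-> _ => apply: sat_family => ?
  | |- _ => exact: iff_refl
  end.

Section Formulas.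
Variables (L S : nat) (M : machine).
Let m := (qi L S).+2.

Definition perfectF (p q : nat) : form :=
  FAnd (FAll 0 (impF (sortF p 0) (FEx 1 (FAnd (sortF q 1) (FAdj 0 1)))))
    (FAll 0 (FAll 1 (FAll 2 (impF (sortF p 0) (impF (sortF q 1) (impF (sortF q 2)
      (impF (FAdj 0 1) (impF (FAdj 0 2) (FEq 1 2))))))))).

Definition codedF : form :=
  FAnd (FAll 0 (bigor (fun i => FOr (FEq 0 (cst i)) (sortF i 0)) m))
  (FAnd (bigand (fun i => bigand (fun j => guardF (i != j) (FNeg (FEq (cst i) (cst j)))) m) m)
  (FAnd (bigand (fun i => bigand (fun j => FNeg (FAdj (cst i) (cst j))) m) m)
  (FAnd (bigand (fun i => bigand (fun j => guardF (i != j)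
    (FAll 0 (impF (sortF i 0) (FNeg (sortF j 0))))) m) m)
  (FAnd (bigand (fun i => FAnd (perfectF 0 i.+1) (perfectF i.+1 0)) m.-1)
  (bigand (fun i => bigand (fun j => guardF ((i == j) || (1 < i) && (1 < j))
    (FAll 0 (FAll 1 (impF (sortF i 0) (impF (sortF j 1) (FNeg (FAdj 0 1))))))) m) m))))).

Definition srcF (s k : nat) : form :=
  match src M s k with
  | None => relF (vi k) 1 9
  | Some (j, false) => FAll 2 (impR (vi j) 0 2 (relF (vi k) 1 2))
  | Some (j, true) => FAll 2 (FAll 3 (impR (vi j) 0 2 (impR 0 2 3 (relF (vi k) 1 3))))
  end.

(** The conjuncts follow the fields of [run_axioms]. Since [bigand] includes its upper bound, strict
    bounds appear as guards. *)
Definition runF : form :=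
  FAnd (sortF 0 9)
  (FAnd (FAll 0 (impF (sortF 0 0) (relF 1 9 0)))
  (FAnd (FAll 0 (FAll 1 (FAll 2 (impR 0 0 1 (impR 1 0 2 (FOr (FEq 2 0) (relF 1 1 2)))))))
  (FAnd (FAll 0 (FAll 1 (impR (qi L S) 0 0 (impR 1 0 1 (FEq 0 1)))))
  (FAnd (FAll 0 (FAll 1 (impR (qi L S) 0 0 (nrelF 0 0 1))))
  (FAnd (FAll 0 (impF (sortF 0 0) (FOr (relF (qi L S) 0 0) (FEx 1 (relF 0 0 1)))))
  (FAnd (FAll 0 (nrelF 0 0 9))
  (FAnd (FAll 0 (FAll 1 (FAll 2 (impR 0 0 2 (impR 0 1 2 (FEq 0 1))))))
  (FAnd (bigand (fun j => guardF (j != 1)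
    (FAll 0 (FAll 1 (FAll 2 (impR j 0 1 (impR j 0 2 (FEq 1 2))))))) (qi L S))
  (FAnd (bigand (fun s => FAll 0 (FAll 1 (impR (qi L s) 0 1 (FEq 0 1)))) S)
  (FAnd (bigand (fun s => bigand (fun s' => guardF (s != s')
    (FAll 0 (impR (qi L s) 0 0 (nrelF (qi L s') 0 0)))) S) S)
  (FAnd (relF (qi L 0) 9 9)
  (FAnd (bigand (fun k => guardF (k < L) (relF (vi k) 9 9)) L)
  (FAnd (bigand (fun s => guardF (s < S) (FAll 0 (FAll 1 (FAll 2 (FAll 3
    (impR 0 0 1 (impR (qi L s) 0 0
      (impR (vi (jmp M s).1.1) 0 2 (impR (vi (jmp M s).1.2) 0 3
        (FOr (FAnd (FEq 2 3) (relF (qi L (jmp M s).2.1) 1 1))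
          (FAnd (FNeg (FEq 2 3)) (relF (qi L (jmp M s).2.2) 1 1))))))))))))  S)
  (bigand (fun s => guardF (s < S) (bigand (fun k => guardF (k < L) (FAll 0 (FAll 1
    (impR 0 0 1 (impR (qi L s) 0 0 (srcF s k)))))) L)) S)))))))))))))).

Section Sat.
Variables (V : Type) (E : V -> V -> Prop) (a : nat -> V).
Let c (i : nat) : V := a (cst i).

Lemma sat_perfectF p q : sat E a (perfectF p q) <-> perfect E c p q.
Proof. by rewrite /perfectF /perfect; repeat sat_step. Qed.

Lemma sat_codedF : sat E a codedF <-> coded E c m.
Proof.
apply: iff_trans (_ : _ <-> _ /\ _ /\ _ /\ _ /\ _ /\ _) _.
  rewrite /codedF.
  apply: sat_and; first by apply: sat_all => v; exact: sat_bigor.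
  do 3 (apply: sat_and; first by repeat sat_step).
  apply: sat_and; last by repeat sat_step.
  by apply: sat_family => i; apply: sat_and; apply: sat_perfectF.
split; first by case=> [h1 [h2 [h3 [h4 [h5 h6]]]]]; split.
by case=> [h1 h2 h3 h4 h5 h6]; do 5 (split=> //).
Qed.

Lemma sat_srcF (b : nat -> V) s k : sat E b (srcF s k) <->
  match src M s k with
  | None => coded_rel E (fun i => b (cst i)) (vi k) (b 1) (b 9)
  | Some (j, false) => forall u, coded_rel E (fun i => b (cst i)) (vi j) (b 0) u ->
      coded_rel E (fun i => b (cst i)) (vi k) (b 1) u
  | Some (j, true) => forall u w, coded_rel E (fun i => b (cst i)) (vi j) (b 0) u ->
      coded_rel E (fun i => b (cst i)) 0 u w -> coded_rel E (fun i => b (cst i)) (vi k) (b 1) w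
  end.
Proof. by rewrite /srcF; case: (src M s k) => [[j []]|]; repeat sat_step. Qed.

Lemma sat_runF :
  sat E a runF <-> run_axioms L S M (fun v => E v (c 0)) (coded_rel E c) (a 9).
Proof.
apply: iff_trans (_ : _ <-> _ /\ _ /\ _ /\ _ /\ _ /\ _ /\ _ /\ _ /\ _ /\ _ /\ _ /\ _ /\ _
  /\ _ /\ _) _.
  rewrite /runF.
  apply: sat_and; first by repeat sat_step.
  apply: sat_and; first by repeat sat_step.
  apply: sat_and; first by repeat sat_step.
  apply: sat_and; first by repeat sat_step.
  apply: sat_and; first by repeat sat_step.
  apply: sat_and; first by repeat sat_step.
  apply: sat_and; first by repeat sat_step.
  apply: sat_and; first by repeat sat_step.
  apply: sat_and; first by repeat sat_step.
  apply: sat_and; first by repeat sat_step.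
  apply: sat_and; first by repeat sat_step.
  apply: sat_and; first by repeat sat_step.
  apply: sat_and; first by repeat sat_step.
  apply: sat_and; first by repeat sat_step.

  do 2 (apply: sat_family => ?; apply: sat_guardF).
  apply: sat_all => u; apply: sat_all => v; do 2 (apply: sat_impR; [exact: isT | exact: isT |]).
  exact: sat_srcF.
split.
  case=> [h1 [h2 [h3 [h4 [h5 [h6 [h7 [h8 [h9 [h10 [h11 [h12 [h13 [h14 h15]]]]]]]]]]]]]].
  split; [exact: h1 | exact: h2 | exact: h3 | exact: h4 | exact: h5 | exact: h6 | exact: h7
    | exact: h8 | exact: h9 | exact: h10 | exact: h11 | exact: h12 | | |].
  - by move=> k kL; apply: h13 => //; apply: ltnW.
  - by move=> s sS; apply: h14 => //; apply: ltnW.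
  - by move=> s sS k kL; apply: h15 => //; apply: ltnW.
case=> [h1 h2 h3 h4 h5 h6 h7 h8 h9 h10 h11 h12 h13 h14 h15].
exact: (conj h1 (conj h2 (conj h3 (conj h4 (conj h5 (conj h6 (conj h7 (conj h8 (conj h9
  (conj h10 (conj h11 (conj h12 (conj (fun k _ => h13 k) (conj (fun s _ => h14 s)
  (fun s _ sS k _ => h15 s sS k))))))))))))))).
Qed.

End Sat.

Definition range_vars : pred nat := fun x => 9 <= x <= m + 10.

(** Two alternations counted from an existential block allow a forall-exists matrix. The rank bound
    9 is a convenient constant, not a sharp one. *)
Definition small (A : form) : bool :=
  [&& nnf A, blk QEx A <= 2, qrank A <= 9 & fv_in range_vars A].

Lemma small_and A B : small A -> small B -> small (FAnd A B).
Proof.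
case/and4P=> a1 a2 a3 a4 /and4P[b1 b2 b3 b4].
by apply/and4P; rewrite qrankE /= !geq_max a1 a2 a3 a4 b1 b2 b3 b4.
Qed.

Lemma small_bigand F n : (forall i, i <= n -> small (F i)) -> small (bigand F n).
Proof.
elim: n => [|n IHn] Fn; first exact: Fn.
by apply: small_and; [apply: IHn => i ?|]; apply: Fn; lia.
Qed.

Lemma small_guardF (b : bool) A : (b -> small A) -> small (guardF b A).
Proof.
case: b => [h|_]; first exact: h.
by rewrite /small qrankE /= /range_vars; lia.
Qed.

Let mE : m = (L + S).+4.
Proof. by []. Qed.

Ltac small_leaf :=
  apply/and4P; split; [by [] | by [] |
    by rewrite /perfectF /relF /impR /nrelF /impF /sortF !qrankE |
    have := mE; rewrite /= /range_vars /cst /vi /qi; lia].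

Lemma small_all_bigor n : n <= m ->
  small (FAll 0 (bigor (fun i => FOr (FEq 0 (cst i)) (sortF i 0)) n)).
Proof.
move=> nm; apply/and4P; split => /=.
- exact: nnf_bigor.
- by rewrite ltnS; apply: (@leq_trans 0) => //; apply: blk_bigor.
- rewrite qrankE; apply: (@leq_ltn_trans 0) => //; apply: qrank_bigor => i _.
  by rewrite /sortF !qrankE.
- by apply: fv_in_bigor => i lein; rewrite /= /range_vars /cst; lia.
Qed.

Lemma small_codedF : small codedF.
Proof.
apply: small_and; first exact: small_all_bigor.
apply: small_and.
  apply: small_bigand => i im; apply: small_bigand => j jm; apply: small_guardF => _.
  small_leaf.
apply: small_and.
  apply: small_bigand => i im; apply: small_bigand => j jm; small_leaf.
apply: small_and.
  apply: small_bigand => i im; apply: small_bigand => j jm; apply: small_guardF => _.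
  small_leaf.
apply: small_and; first by apply: small_bigand => i im; small_leaf.
apply: small_bigand => i im; apply: small_bigand => j jm; apply: small_guardF => _.
small_leaf.
Qed.

Hypotheses (jmpM : forall s, s < S -> [/\ (jmp M s).1.1 < L, (jmp M s).1.2 < L,
    (jmp M s).2.1 <= S & (jmp M s).2.2 <= S])
  (srcM : forall s k j b, s < S -> k < L -> src M s k = Some (j, b) -> j < L).

Lemma small_runF : small runF.
Proof.
rewrite /runF.
do 8 (apply: small_and; first by small_leaf).
apply: small_and; first by apply: small_bigand => j; rewrite /qi => jS;
  apply: small_guardF => _; small_leaf.
apply: small_and; first by apply: small_bigand => s sS; small_leaf.
apply: small_and.
  apply: small_bigand => s sS; apply: small_bigand => s' s'S; apply: small_guardF => _.
  small_leaf.
apply: small_and; first by small_leaf.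
apply: small_and; first by apply: small_bigand => k _; apply: small_guardF => kL; small_leaf.
apply: small_and.
  apply: small_bigand => s _; apply: small_guardF => sS.
  have [iL jL d1 d2] := jmpM sS; small_leaf.
apply: small_bigand => s _; apply: small_guardF => sS.
apply: small_bigand => k _; apply: small_guardF => kL.
rewrite /srcF; case Esrc: (src M s k) => [[j b]|]; last by small_leaf.
have jL := srcM sS kL Esrc.
by case: b {Esrc}; small_leaf.
Qed.

End Formulas.

Definition code_sentence (L S : nat) (M : machine) : form :=
  exs (iota 9 (qi L S).+4) (FAnd (codedF L S) (runF L S M)).

Section Sentence.
Variables (L S N : nat) (M : machine) (st : nat -> nat) (reg : nat -> nat -> nat).
Hypothesis run : halting_run L S N M st reg.

Lemma small_code_body : small L S (FAnd (codedF L S) (runF L S M)).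
Proof.
apply: small_and; first exact: small_codedF.
apply: small_runF; [exact: run_jmp run | exact: run_src run].
Qed.

Lemma nnf_code_sentence : nnf (code_sentence L S M).
Proof. by rewrite nnf_exs; case/and4P: small_code_body. Qed.

Lemma alt_code_sentence : alt (code_sentence L S M) <= 2.
Proof.
by apply: leq_trans (alt_le_blk QEx _) _; rewrite blk_exs; case/and4P: small_code_body.
Qed.

(** The outer block binds [L + S + 6] variables, the markers and the least element, and the matrix
    has rank at most 9. *)
Lemma qrank_code_sentence : qrank (code_sentence L S M) <= L + S + 15.
Proof.
have /and4P[_ _ rk _] := small_code_body; rewrite qrank_exs size_iota /qi; lia.
Qed.

Lemma sentence_code_sentence : sentence (code_sentence L S M).
Proof.
have /and4P[_ _ _ fvA] := small_code_body; apply: sentence_exs.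
apply: sub_fv_in fvA => x; rewrite /range_vars /qi => xm.
by have : x \in iota 9 (L + S).+2.+4 by rewrite mem_iota; lia.
Qed.

Lemma sat_code_sentence (V : Type) (E : V -> V -> Prop) (a : nat -> V) :
  sat E a (code_sentence L S M) <->
  exists (c : nat -> V) (z : V), coded E c (qi L S).+2 /\
    run_axioms L S M (fun v => E v (c 0)) (coded_rel E c) z.
Proof.
split=> [/sat_exs[b _ [/sat_codedF codE /sat_runF ax]]|[c [z [codE ax]]]].
  by exists (fun i => b (cst i)), (b 9).
pose b x := match x with n.+4.+4.+2 => c n | _ => z end.
have satb : sat E b (code_sentence L S M).
  by apply/sat_exs; exists b => //; split; [apply/sat_codedF | apply/sat_runF].
apply: (proj1 (sat_ext _ _)) satb => x.
by have := sentence_code_sentence; rewrite /sentence => /nilP ->.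
Qed.

(** [N] occurs in the graph but not in the sentence; it is recovered in every model because the run
    is known to halt after [N] steps. *)
Lemma defines_code_sentence :
  defines (code_edge (L := L) (S := S) (N := N) st reg) (code_sentence L S M).
Proof.
split; first exact: sentence_code_sentence.
split=> [a|H satH].
  apply/sat_code_sentence; exists (@marker L S N), (element L S N 0).
  split; first exact: coded_code_graph.
  exact: (embeds_run_axioms run (embeds_code_graph L S N st reg)).
have [h] := gV_inh H; have /sat_code_sentence[c [z [codE ax]]] := satH (fun=> h).
have [zs emb] := run_axioms_embeds run (@coded_relD _ (@gE H) c) ax.
have [g [g_inj g_surj gE']] := code_graph_rigid (@gE_sym H) codE emb.
exact: iso_finP g_inj g_surj gE'.
Qed.

End Sentence.

(** * Comparison of the two ranks *)

Lemma reval_comp1 g h xs y z : reval h xs y -> reval g [:: y] z -> reval (RComp g [:: h]) xs z.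
Proof. by move=> evh; apply: ev_comp (evl_cons evh (evl_nil _ )). Qed.

Lemma reval_comp2 g h1 h2 xs y1 y2 z : reval h1 xs y1 -> reval h2 xs y2 ->
  reval g [:: y1; y2] z -> reval (RComp g [:: h1; h2]) xs z.
Proof. by move=> ev1 ev2; apply: ev_comp (evl_cons ev1 (evl_cons ev2 (evl_nil _))). Qed.

Lemma reval_proj i xs y : i < size xs -> nth 0 xs i = y -> reval (RProj i) xs y.
Proof. by move=> ixs <-; constructor. Qed.

Definition add_rfun : rfun := RPrec (RProj 0) (RComp RSucc [:: RProj 1]).

Lemma reval_add x y : reval add_rfun [:: x; y] (x + y).
Proof.
elim: x => [|x IHx]; first by constructor; apply: reval_proj.
apply: ev_precS IHx _; apply: reval_comp1 (ev_succ _ _).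
exact: reval_proj.
Qed.

Definition double_rfun (h : rfun) : rfun := RComp add_rfun [:: h; h].

Lemma reval_double h xs y : reval h xs y -> reval (double_rfun h) xs (y + y).
Proof. by move=> ev; apply: reval_comp2 (ev) (ev) (reval_add _ _). Qed.

Definition exp4_rfun : rfun :=
  RPrec (RComp RSucc [:: RZero]) (double_rfun (double_rfun (RProj 1))).

Lemma reval_exp4 n : reval exp4_rfun [:: n] (4 ^ n).
Proof.
elim: n => [|n IHn]; first by constructor; apply: reval_comp1 (ev_zero _) (ev_succ _ _).
apply: ev_precS IHn _; rewrite (_ : 4 ^ n.+1 = 4 ^ n + 4 ^ n + (4 ^ n + 4 ^ n)).
  by do 2 apply: reval_double; apply: reval_proj.
by rewrite expnS; lia.
Qed.

Definition tower_rfun : rfun := RPrec (RProj 0) (RComp exp4_rfun [:: RProj 1]).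

Lemma reval_tower k n : reval tower_rfun [:: k; n] (tower k n).
Proof.
elim: k => [|k IHk]; first by constructor; apply: reval_proj.
by apply: ev_precS IHk _; apply: reval_comp1 (reval_exp4 _); apply: reval_proj.
Qed.

Definition size_bound_rfun (h : rfun) : rfun :=
  RComp tower_rfun [:: RComp RSucc [:: RComp RSucc [:: h]]; RComp RSucc [:: h]].

Lemma reval_size_bound h xs n : reval h xs n -> reval (size_bound_rfun h) xs (size_bound n).
Proof.
have succ h' m : reval h' xs m -> reval (RComp RSucc [:: h']) xs m.+1.
  by move=> ev; apply: reval_comp1 ev (ev_succ _ _).
by move=> ev; apply: reval_comp2 (succ _ _ (succ _ _ ev)) (succ _ _ ev) (reval_tower _ _).
Qed.

(** The recursion has no parameters, so its base case is evaluated on the empty list, where the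
    argument 0 comes from [RZero]. The outer composition supplies twice the input as the recursion
    argument. *)
Definition cumulative_rfun (p : rfun) : rfun :=
  RComp (RPrec (size_bound_rfun (RComp p [:: RZero]))
      (RComp add_rfun [:: RProj 1; size_bound_rfun (RComp p [:: RComp RSucc [:: RProj 0]])]))
    [:: double_rfun (RProj 0)].

Definition cumulative (f : nat -> nat) (n : nat) : nat := \sum_(i < n.+1) size_bound (f i).

Lemma reval_cumulative p f n : (forall n, reval p [:: n] (f n)) ->
  reval (cumulative_rfun p) [:: n] (cumulative f (n + n)).
Proof.
move=> ev_p; apply: (@reval_comp1 _ _ _ (n + n)).
  by apply: reval_double; apply: reval_proj.
elim: (n + n) => [|k IHk].
  rewrite /cumulative big_ord1; constructor; apply: reval_size_bound.
  exact: reval_comp1 (ev_zero _) (ev_p 0).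
apply: ev_precS IHk _.
rewrite (_ : cumulative f k.+1 = cumulative f k + size_bound (f k.+1)); last first.
  by rewrite /cumulative big_ord_recr.
apply: reval_comp2 _ _ (reval_add _ _); first exact: reval_proj.
apply: reval_size_bound; apply: reval_comp1 (ev_p _).
by apply: reval_comp1 (ev_succ _ _); apply: reval_proj.
Qed.

Lemma leq_cumulative f n i : i <= n -> size_bound (f i) <= cumulative f n.
Proof.
rewrite -ltnS => lt_in.
by rewrite /cumulative (bigD1 (Ordinal lt_in)) //= leq_addr.
Qed.

(** Definability with a given rank is not decidable, hence classical reasoning. The bound by the
    given example is kept, since it is what limits $D_3$. *)
Lemma ex_least (P : nat -> Prop) n : P n ->
  exists2 m, P m /\ m <= n & forall k, P k -> m <= k.
Proof.
elim/ltn_ind: n => n IHn Pn; have [[k [lt_kn Pk]]|noP] := classic (exists k, k < n /\ P k).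
  by have [m [Pm mk] minm] := IHn k lt_kn Pk; exists m => //; split=> //; lia.
by exists n => // k Pk; rewrite leqNgt; apply/negP => lt_kn; apply: noP; exists k.
Qed.

Theorem theorem5p4 :
  ~ exists f : nat -> nat,
      general_recursive f /\
      forall (T : finType) (e : rel T),
        symmetric e -> irreflexive e -> 0 < #|T| ->
        forall n m, D3 e n -> Dhalf e m -> m <= f n.
Proof.
case=> f [[p ev_p] boundf].
have [L [C runs_f]] := halting_run_rfun (cumulative_rfun p).
(* The rank [L + (x + C) + 15] of the coding sentence equals [x + x] for this choice. *)
pose x := L + C + 15.
have [N [M [st [reg [run leN]]]]] := runs_f x _ (reval_cumulative x ev_p).
pose T := code_vertex L (x + C) N; pose e : rel T := code_edge st reg.
have symE : symmetric e by apply: code_edge_sym.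
have irrE : irreflexive e by apply: code_edge_irr.
have cardT : N < #|T| by apply: card_code_vertex.
have T_gt0 : 0 < #|T| by apply: leq_ltn_trans cardT.
have [t0 _] := card_gt0P T_gt0.
pose A := code_sentence L (x + C) M.
have [n [[B [nnfB altB rkB defB]] le_n] min_n] : exists2 n,
    (exists B, [/\ nnf B, alt B <= 3, qrank B = n & defines e B]) /\ n <= qrank A &
    forall k, (exists B, [/\ nnf B, alt B <= 3, qrank B = k & defines e B]) -> n <= k.
  apply: ex_least; exists A; split=> //; first exact: nnf_code_sentence run.
    by apply: leq_trans (alt_code_sentence run) _.
  exact: defines_code_sentence.
have D3n : D3 e n.
  by split; [exists B | move=> B' nB' aB' dB'; apply: min_n; exists B'].
have [m [[B' [phiB' rkB' defB']] _] min_m] : exists2 m,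
    (exists B, [/\ in_Phi B, qrank B = m & defines e B]) /\ m <= qrank (diagram e t0) &
    forall k, (exists B, [/\ in_Phi B, qrank B = k & defines e B]) -> m <= k.
  apply: ex_least; exists (diagram e t0); split=> //; first exact: in_Phi_diagram.
  exact: defines_diagram.
have Dhalfm : Dhalf e m.
  by split; [exists B' | move=> B'' pB' dB'; apply: min_m; exists B''].
have le_mf := boundf T e symE irrE T_gt0 n m D3n Dhalfm.
have le_nx : n <= x + x.
  by apply: leq_trans le_n _; apply: leq_trans (qrank_code_sentence run) _; rewrite /x; lia.
have le_T := card_defines_Phi symE irrE T_gt0 phiB' defB'.
(* The contradiction is [N < #|T| <= size_bound m <= size_bound (f n) <= cumulative f (x + x) <=
   N]. *)
have := leq_trans cardT le_T; rewrite rkB' ltnNge => /negP; apply.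
apply: leq_trans leN; apply: leq_trans (leq_cumulative f le_nx).
exact: leq_size_bound.
Qed.
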